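(* Consider a unichain turn-based stochastic game with $n$ states such that the transition probabilities $P_{ij}^{a,b}$ are rational numbers with a common denominator $M$ and the payments $r_i^{a,b}$ are integers. Let $T$ be its Shapley operator, $\theta=p_{\min}/(1+p_{\min})$, $T_\theta=\theta I+(1-\theta)T$, $k_{\mathrm{uni}}$ its unichain index, $\|r\|_\infty=\max_{i,a,b}|r_i^{a,b}|$, and let $$\epsilon=(1-\theta)\,(n^2M^{2(n-1)})^{-1}.$$ Then the algorithm RVI (described in the context), applied to $T_\theta$ with requested precision $\epsilon$ and oracle accuracy $\eta>0$ satisfying $\eta\,(12+24\,k_{\mathrm{uni}}\,\theta^{-k_{\mathrm{uni}}})\le\epsilon$, runs in at most $$\bigl(|\log(1-\theta)|+2\log n+2(n-1)\log M+\log 12+\log\|r\|_\infty\bigr)\,\theta^{-k_{\mathrm{uni}}}\,k_{\mathrm{uni}}$$ iterations. Moreover, let $x^*$ be the vector returned by the algorithm, and let $\sigma^*,\tau^*$ be pure policies of Min and Max reaching respectively the minimum and the maximum in the expression of $T(x^* )$, i.e., for all $i\in[n]$, $$T_i(x^* )=\max_{b\in B(i)}\Big(r_i^{\sigma^*(i),b}+\sum_{j\in[n]}P_{ij}^{\sigma^*(i),b}x^*_j\Big)=\min_{a\in A(i)}\Big(r_i^{a,\tau^*(i)}+\sum_{j\in[n]}P_{ij}^{a,\tau^*(i)}x^*_j\Big).$$ Then these policies are optimal in the mean-payoff game.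
   Context: Notation: $[n]=\{1,\dots,n\}$; $e$ is the all-ones vector; $\mathbf t(x)=\max_i x_i$, $\mathbf b(x)=\min_i x_i$, $\|x\|_{\mathrm H}=\mathbf t(x)-\mathbf b(x)$ (Hilbert's seminorm). Turn-based game: the state space is $[n]$; for each state $i$ there are nonempty finite action sets $A(i)$ (player Min) and $B(i)$ (player Max), at least one of which is a singleton; for each $(a,b)\in A(i)\times B(i)$ there is a payment $r_i^{a,b}\in\mathbb{R}$ and a stochastic vector $(P_{ij}^{a,b})_{j\in[n]}$. The Shapley operator is $T_i(v)=\min_{a\in A(i)}\max_{b\in B(i)}\big(r_i^{a,b}+\sum_jP_{ij}^{a,b}v_j\big)$ (min and max commute). Mean-payoff game: at each stage $k\ge0$, in state $i_k$, knowing the history (all past states and actions, and $i_k$), Min and Max choose (possibly randomly and independently) actions $a_k\in A(i_k)$, $b_k\in B(i_k)$; Min pays $r_{i_k}^{a_k,b_k}$ to Max and the next state is $j$ with probability $P_{i_kj}^{a_kb_k}$. A strategy assigns to each history a probability measure on the player's current action set. $J^N_{i_0}(\sigma,\tau)$ is the expectation of $\sum_{k=0}^{N-1}r_{i_k}^{a_k,b_k}$ from initial state $i_0$, and $\chi^{+}_{i_0}(\sigma,\tau)$, $\chi^-_{i_0}(\sigma,\tau)$ are the $\limsup$ and $\liminf$ of $J^N_{i_0}(\sigma,\tau)/N$ as $N\to\infty$. A pure policy of Min (resp. Max) is a map $\sigma$ with $\sigma(i)\in A(i)$ (resp. $\tau$ with $\tau(i)\in B(i)$), identified with the stationary strategy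 playing $\sigma(i)$ (resp. $\tau(i)$) whenever in state $i$. Policies $\sigma^*,\tau^*$ are optimal if, with $\chi^*\in\mathbb{R}^n$ the value vector of the mean-payoff game, $\chi^+(\sigma^*,\tau)\le\chi^*\le\chi^-(\sigma,\tau^* )$ for all strategies $\sigma,\tau$. $P^{\sigma,\tau}=(P_{ij}^{\sigma(i),\tau(i)})_{i,j}$. A nonnegative matrix is unichain if its digraph (arc $i\to j$ iff entry $ij$ is positive) has a unique final strongly connected component (final: any path starting in it stays in it). The game is unichain if every $P^{\sigma,\tau}$, for pure policies $\sigma,\tau$, is unichain. $p_{\min}=\min\{P_{ij}^{a,b}: i\ne j,\ (a,b)\in A(i)\times B(i),\ P_{ij}^{a,b}>0\}$ (presupposed to exist, which is automatic for $n\ge2$), $Q^{\sigma,\tau}=\theta I+(1-\theta)P^{\sigma,\tau}$. The unichain index $k_{\mathrm{uni}}$ is the smallest integer $k$ such that for all $i_1,i_2\in[n]$ and all sequences $(\sigma_1,\tau_1),\dots,(\sigma_k,\tau_k)$ of pairs of pure policies, rows $i_1$ and $i_2$ of $Q^{\sigma_1,\tau_1}\cdots Q^{\sigma_k,\tau_k}$ have a common column in which both are positive (such $k\le n$ exists). Algorithm RVI, applied to an operator $S:\mathbb{R}^n\to\mathbb{R}^n$, with requested precision $\epsilon>0$ and an oracle $\tilde S$ of accuracy $\eta\le\epsilon/3$, i.e. $\|\tilde S(x)-S(x)\|_\infty\le\eta$ for all $x$: start from $x:=0$; repeat $x:=\tilde S(x)-\mathbf t(\tilde S(x))e$ until $\|x-\tilde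 S(x)\|_{\mathrm H}\le\epsilon/3$; then return $x$, $\alpha:=\mathbf b(\tilde S(x)-x)$, $\beta:=\mathbf t(\tilde S(x)-x)$. An iteration is one execution of the body of the loop. *)

(* Defs.v *)
From mathcomp Require Import all_boot all_order all_algebra.
From mathcomp Require Import all_classical all_reals all_analysis.
Import Order.TTheory GRing.Theory Num.Theory.
Import numFieldNormedType.Exports.

Set Implicit Arguments.
Unset Strict Implicit.
Unset Printing Implicit Defensive.

Local Open Scope classical_set_scope.
Local Open Scope ring_scope.

(* The maximum and minimum of f over the elements of a finite type that satisfy
   p; the value 0 is only a default, for when there is no such element. *)
Definition fmax (R : realType) (I : finType) (p : pred I) (f : I -> R) : R :=
  if [pick i | p i] is Some i0 then \big[Num.max/f i0]_(i | p i) f i else 0.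
Definition fmin (R : realType) (I : finType) (p : pred I) (f : I -> R) : R :=
  if [pick i | p i] is Some i0 then \big[Num.min/f i0]_(i | p i) f i else 0.

Section Vectors.
Context {R : realType} {n : nat}.
Implicit Type x : 'cV[R]_n.

Definition top x : R := fmax predT (fun i => x i 0).
Definition bot x : R := fmin predT (fun i => x i 0).
Definition hilbert_seminorm x : R := top x - bot x.

End Vectors.

Section Digraph.
Context {R : realType} {n : nat}.
Implicit Types (Q : 'M[R]_n) (C : {set 'I_n}).

Definition arc Q : rel 'I_n := fun i j => 0 < Q i j.

Definition strong_component Q C : Prop :=
  exists i, C = [set j | connect (arc Q) i j && connect (arc Q) j i]%SET.

Definition final_set Q C : Prop :=
  forall i j, i \in C -> connect (arc Q) i j -> j \in C.

Definition unichain Q : Prop :=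
  exists! C, strong_component Q C /\ final_set Q C.

End Digraph.

Record game (R : realType) (n : nat) := Game {
  minact : 'I_n -> finType;
  maxact : 'I_n -> finType;
  payment : forall i, minact i -> maxact i -> R;
  trans : forall i, minact i -> maxact i -> 'I_n -> R;
  minact_gt0 : forall i, (0 < #|minact i|)%N;
  maxact_gt0 : forall i, (0 < #|maxact i|)%N;
  turn_based : forall i, #|minact i| = 1%N \/ #|maxact i| = 1%N;
  trans_ge0 : forall i (a : minact i) (b : maxact i) j, 0 <= trans a b j;
  trans_sum1 : forall i (a : minact i) (b : maxact i),
    \sum_(j < n) trans a b j = 1 }.

Arguments payment {R n} g {i} _ _.
Arguments trans {R n} g {i} _ _ _.

Record fdist (R : realType) (T : finType) := FDist {
  fdist_fun :> T -> R;
  fdist_ge0 : forall t, 0 <= fdist_fun t;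
  fdist_sum1 : \sum_t fdist_fun t = 1 }.

Section Dirac.
Context {R : realType} {T : finType}.

Fact point_mass_ge0 (t0 : T) t : 0 <= (t == t0)%:R :> R.
Proof. exact: ler0n. Qed.

Fact point_mass_sum1 (t0 : T) : \sum_t (t == t0)%:R = 1 :> R.
Proof.
rewrite (bigD1 t0) //= eqxx big1 ?addr0 // => t /negbTE -> //.
Qed.

Definition point_mass (t0 : T) : fdist R T :=
  FDist (point_mass_ge0 t0) (point_mass_sum1 t0).

End Dirac.

Section Game.
Context {R : realType} {n : nat} (G : game R n).

Definition min_policy : Type := forall i, minact G i.
Definition max_policy : Type := forall i, maxact G i.

(* The state, Min's action and Max's action at one stage. *)
Definition stage : Type := {i : 'I_n & (minact G i * maxact G i)%type}.

Definition stage_state (s : stage) : 'I_n := tag s.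
Definition stage_min (s : stage) : minact G (stage_state s) := (tagged s).1.
Definition stage_max (s : stage) : maxact G (stage_state s) := (tagged s).2.
Definition stage_payment (s : stage) : R :=
  payment G (stage_min s) (stage_max s).
Definition stage_trans (s : stage) : 'I_n -> R :=
  trans G (stage_min s) (stage_max s).

Section Operator.
Implicit Type x : 'cV[R]_n.

Definition local_value x i (a : minact G i) (b : maxact G i) : R :=
  payment G a b + \sum_(j < n) trans G a b j * x j 0.

Definition shapley x : 'cV[R]_n :=
  \col_i fmin predT (fun a => fmax predT (fun b => local_value x (i:=i) a b)).

Definition damped_shapley (theta : R) x : 'cV[R]_n :=
  theta *: x + (1 - theta) *: shapley x.

(* sigma and tau attain the minimum, resp. the maximum, in shapley x. *)
Definition greedy x (sigma : min_policy) (tau : max_policy) : Prop :=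
  forall i,
    shapley x i 0 = fmax predT (fun b => local_value x (sigma i) b) /\
    shapley x i 0 = fmin predT (fun a => local_value x a (tau i)).

End Operator.

(* A history is the sequence of past stages followed by the current state. *)
Definition min_strategy : Type := seq stage -> forall i, fdist R (minact G i).
Definition max_strategy : Type := seq stage -> forall i, fdist R (maxact G i).

Definition min_stationary (sigma : min_policy) : min_strategy :=
  fun _ i => point_mass (sigma i).
Definition max_stationary (tau : max_policy) : max_strategy :=
  fun _ i => point_mass (tau i).

(* Probability that the stages following the past h are w, when the current
   state has law mu. *)
Fixpoint play_prob (sigma : min_strategy) (tau : max_strategy)
    (h : seq stage) (mu : 'I_n -> R) (w : seq stage) : R :=
  if w is s :: w' then
    mu (stage_state s)
    * (sigma h (stage_state s) (stage_min s)
       * tau h (stage_state s) (stage_max s))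
    * play_prob sigma tau (rcons h s) (stage_trans s) w'
  else 1.

Definition expected_payment (i0 : 'I_n) (sigma : min_strategy)
    (tau : max_strategy) (N : nat) : R :=
  \sum_(w : N.-tuple stage)
    play_prob sigma tau [::] (point_mass i0) w * \sum_(s <- w) stage_payment s.

Definition chi_sup (i0 : 'I_n) sigma tau : \bar R :=
  limn_esup (fun N => (expected_payment i0 sigma tau N / N%:R)%:E).
Definition chi_inf (i0 : 'I_n) sigma tau : \bar R :=
  limn_einf (fun N => (expected_payment i0 sigma tau N / N%:R)%:E).

Definition is_value (chi : 'cV[R]_n) : Prop := forall i,
  ereal_inf (range (fun sigma =>
    ereal_sup (range (fun tau => chi_sup i sigma tau)))) = (chi i 0)%:E /\
  ereal_sup (range (fun tau =>
    ereal_inf (range (fun sigma => chi_inf i sigma tau)))) = (chi i 0)%:E.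

Definition optimal_policies (sigma : min_policy) (tau : max_policy) : Prop :=
  exists2 chi : 'cV[R]_n, is_value chi &
    forall i (sigma' : min_strategy) (tau' : max_strategy),
      (chi_sup i (min_stationary sigma) tau' <= (chi i 0)%:E)%E /\
      ((chi i 0)%:E <= chi_inf i sigma' (max_stationary tau))%E.

Definition policy_mx (sigma : min_policy) (tau : max_policy) : 'M[R]_n :=
  \matrix_(i, j) trans G (sigma i) (tau i) j.

Definition unichain_game : Prop :=
  forall sigma tau, unichain (policy_mx sigma tau).

Definition positive_offdiag : pred (stage * 'I_n) :=
  fun u => (stage_state u.1 != u.2) && (0 < stage_trans u.1 u.2).

Definition p_min : R :=
  fmin positive_offdiag (fun u => stage_trans u.1 u.2).

Definition damped_mx (theta : R) sigma tau : 'M[R]_n :=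
  theta%:M + (1 - theta) *: policy_mx sigma tau.

Definition scrambling (theta : R) (k : nat) : Prop :=
  forall (i1 i2 : 'I_n) (s : 'I_k -> min_policy * max_policy),
    let Q := \big[mulmx/1%:M]_(l < k) damped_mx theta (s l).1 (s l).2 in
    exists j, 0 < Q i1 j /\ 0 < Q i2 j.

(* The default 0 is not used: for a unichain game and 0 < theta < 1 some k <= n
   is scrambling. *)
Definition unichain_index (theta : R) : nat :=
  xget 0%N [set k | scrambling theta k /\
                    forall k', scrambling theta k' -> (k <= k')%N].

(* If all payments vanish this is 0, and its library logarithm is 0, not -oo. *)
Definition payment_norm : R := fmax predT (fun s => `|stage_payment s|).

End Game.

Section RVI.
Context {R : realType} {n : nat}.
Context (S : 'cV[R]_n -> 'cV[R]_n) (eps : R).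

Definition rvi_step (x : 'cV[R]_n) : 'cV[R]_n := S x - const_mx (top (S x)).
Definition rvi_iter (m : nat) : 'cV[R]_n := iter m rvi_step 0.
Definition rvi_test (x : 'cV[R]_n) : bool :=
  hilbert_seminorm (x - S x) <= eps / 3.

(* Run with the oracle S and precision eps, the algorithm halts after exactly N
   iterations and returns x, alpha, beta. *)
Definition rvi_returns (N : nat) (x : 'cV[R]_n) (alpha beta : R) : Prop :=
  [/\ (0 < N)%N /\ rvi_test (rvi_iter N),
      forall m, (0 < m < N)%N -> ~~ rvi_test (rvi_iter m),
      x = rvi_iter N,
      alpha = bot (S x - x) &
      beta = top (S x - x)].

End RVI.

(* Main.v *)
Require Import Defs.
From mathcomp Require Import all_boot all_order all_algebra.
From mathcomp Require Import all_classical all_reals all_analysis.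
From mathcomp Require Import ring lra zify.
Import Order.TTheory GRing.Theory Num.Theory.
Import numFieldNormedType.Exports.

(** The damped operator F = T_theta contracts Hilbert's seminorm in k = k_uni
    steps. Each coordinate of T(x) - T(y) is bounded above, and likewise below,
    by the image of x - y under a transition row available in that state.
    Applied to a linear form u, choosing the upper or the lower row according
    to the sign of each coefficient, this gives
      u (F^k x - F^k y) <= u Q_1 ... Q_k (x - y)
    for pure policies depending on u [iter_dominated]. For u = e_i1 - e_i2 the
    same product acts on both rows, so they share a column of positive entries,
    each at least theta^k because every positive entry of a damped matrix is at
    least theta; hence the contraction factor 1 - theta^k [iter_contraction].
    Such a k exists: as long as two rows of a product have disjoint supports,
    one of the supports grows at each further step, for otherwise some policy
    pair would have two disjoint closed sets [support_disjoint].

    An oracle error eta perturbs each iterate by at most 2 eta in Hilbert's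
    seminorm, so the successive increments decay geometrically up to a term
    4 k eta theta^(-k) [noisy_increments]. The increment is the quantity tested
    by the algorithm, and comparing the decay with exp gives the bound on the
    number of iterations [rvi_stops, phase_bound].

    At termination the vector x satisfies x + a <= T(x) <= x + b with
    b - a < 1 / (n^2 M^(2(n-1))). A pair of pure policies has an invariant
    vector with integer entries between 0 and M^(n-1), namely the principal
    minors of the Laplacian M (I - P) [integer_invariant_vector]; its gain is
    therefore a fraction of denominator at most n M^(n-1), and two distinct
    gains differ by at least 1 / (n^2 M^(2(n-1))) [gain_gap]. Let chi be the
    gain of the greedy pair. It lies in [a, b]; any pure reply of Max to the
    greedy policy of Min gains at most b, so the gap forces it to gain at most
    chi, and symmetrically for Min.

    Pure replies are enough: the one-player operator left by a fixed policy is
    contracting as well, so it has approximate additive eigenvectors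
    [approximate_eigenvector]. Such a vector is a potential bounding the
    long-run average payment under every history-dependent reply, up to a small
    error, by the gain of a pure reply [chi_sup_le_gain, chi_inf_ge_gain]. The
    greedy pair is then a saddle point with value chi [saddle_optimal]. *)

Set Implicit Arguments.
Unset Strict Implicit.
Unset Printing Implicit Defensive.

Local Open Scope ring_scope.

(** * Extrema and Hilbert's seminorm *)

Section Extrema.
Context {R : realType} {I : finType}.
Implicit Types (p : pred I) (f : I -> R).

Lemma fmax_ge p f i : p i -> f i <= fmax p f.
Proof.
move=> pi; rewrite /fmax; case: pickP => [i0 _|/(_ i)]; last by rewrite pi.
exact: le_bigmax_cond.
Qed.

Lemma fmin_le p f i : p i -> fmin p f <= f i.
Proof.
move=> pi; rewrite /fmin; case: pickP => [i0 _|/(_ i)]; last by rewrite pi.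
exact: bigmin_le_cond.
Qed.

Lemma fmax_attained p f i : p i -> exists2 j, p j & fmax p f = f j.
Proof.
move=> pi; rewrite /fmax; case: pickP => [i0 pi0|/(_ i)]; last by rewrite pi.
apply: (big_ind (fun v => exists2 j, p j & v = f j)).
- by exists i0.
- move=> _ _ [j pj ->] [l pl ->]; rewrite /Num.max.
  by case: ifP => _; [exists l|exists j].
- by move=> j pj; exists j.
Qed.

Lemma fmin_attained p f i : p i -> exists2 j, p j & fmin p f = f j.
Proof.
move=> pi; rewrite /fmin; case: pickP => [i0 pi0|/(_ i)]; last by rewrite pi.
apply: (big_ind (fun v => exists2 j, p j & v = f j)).
- by exists i0.
- move=> _ _ [j pj ->] [l pl ->]; rewrite /Num.min.
  by case: ifP => _; [exists j|exists l].
- by move=> j pj; exists j.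
Qed.

End Extrema.

Section HilbertSeminorm.
Context {R : realType} {n : nat}.
Implicit Types x y : 'cV[R]_n.

Lemma top_ge x i : x i 0 <= top x.
Proof. exact: (@fmax_ge _ _ predT (fun i => x i 0)). Qed.
Lemma bot_le x i : bot x <= x i 0.
Proof. exact: (@fmin_le _ _ predT (fun i => x i 0)). Qed.

Lemma top_attained x (i : 'I_n) : exists j, top x = x j 0.
Proof.
by have [j _ ?] := @fmax_attained _ _ predT (fun i => x i 0) i isT; exists j.
Qed.

Lemma bot_attained x (i : 'I_n) : exists j, bot x = x j 0.
Proof.
by have [j _ ?] := @fmin_attained _ _ predT (fun i => x i 0) i isT; exists j.
Qed.

Lemma hilbert_ge x i j : x i 0 - x j 0 <= hilbert_seminorm x.
Proof. by apply: lerB; [exact: top_ge|exact: bot_le]. Qed.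

Lemma hilbert_le x (i0 : 'I_n) c :
  (forall i j, x i 0 - x j 0 <= c) -> hilbert_seminorm x <= c.
Proof.
move=> h; rewrite /hilbert_seminorm.
by have [i ->] := top_attained x i0; have [j ->] := bot_attained x i0.
Qed.

Lemma hilbert_ge0 x (i0 : 'I_n) : 0 <= hilbert_seminorm x.
Proof. by have := hilbert_ge x i0 i0; rewrite subrr. Qed.

Lemma hilbertD x y (i0 : 'I_n) :
  hilbert_seminorm (x + y) <= hilbert_seminorm x + hilbert_seminorm y.
Proof.
apply: (hilbert_le i0) => i j; rewrite !mxE.
have := hilbert_ge x i j; have := hilbert_ge y i j; lra.
Qed.

Lemma hilbertN x (i0 : 'I_n) : hilbert_seminorm (- x) = hilbert_seminorm x.
Proof.
apply/eqP; rewrite eq_le; apply/andP; split; apply: (hilbert_le i0) => i j.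
  by rewrite !mxE; have := hilbert_ge x j i; lra.
by have := hilbert_ge (- x) j i; rewrite !mxE; lra.
Qed.

Lemma hilbertZ x (i0 : 'I_n) c : 0 <= c ->
  hilbert_seminorm (c *: x) <= c * hilbert_seminorm x.
Proof.
move=> c0; apply: (hilbert_le i0) => i j; rewrite !mxE -mulrBr.
by rewrite ler_wpM2l// hilbert_ge.
Qed.

Lemma hilbert_const x (i0 : 'I_n) c :
  hilbert_seminorm (x + const_mx c) = hilbert_seminorm x.
Proof.
apply/eqP; rewrite eq_le; apply/andP; split; apply: (hilbert_le i0) => i j.
  by rewrite !mxE; have := hilbert_ge x i j; lra.
by have := hilbert_ge (x + const_mx c) i j; rewrite !mxE; lra.
Qed.

Lemma normmx_ge (x : 'cV[R]_n) i : `|x i 0| <= `|x|.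
Proof.
rewrite [leRHS]mx_normrE.
exact: (le_bigmax _ (fun ij => `|x ij.1 ij.2|) (i, 0)).
Qed.

Lemma hilbert_norm x (i0 : 'I_n) c : `|x| <= c -> hilbert_seminorm x <= 2 * c.
Proof.
move=> xc; apply: (hilbert_le i0) => i j.
have := le_trans (normmx_ge x i) xc; have := le_trans (normmx_ge x j) xc.
rewrite !ler_norml => /andP[? ?] /andP[? ?]; lra.
Qed.

End HilbertSeminorm.

(** * Unichain digraphs and scrambling products *)

Section ClosedSets.
Context {R : realType} {n : nat}.
Implicit Types (Q : 'M[R]_n) (C : {set 'I_n}).

Lemma final_set_arc Q C :
  (forall i j, i \in C -> 0 < Q i j -> j \in C) -> final_set Q C.
Proof.
move=> h i j iC /connectP[p].
elim: p i iC => [|l p IH] i iC /=; first by move=> _ ->.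
by case/andP => il; apply: IH; exact: h il.
Qed.

(** In a closed set, a state that reaches as few states as possible generates a
    final strong component. There is only one such component, so any of its
    states will do. *)
Lemma unichain_recurrent Q : unichain Q ->
  exists j, forall C, C != finset.set0 -> final_set Q C -> j \in C.
Proof.
move=> [C0 [[[j0 C0E] _] C0u]]; exists j0 => C /set0Pn[i1 i1C] Cf.
pose reach i := [set j | connect (Defs.arc Q) i j]%SET.
have [i iC imin] := @arg_minnP _ i1 (mem C) (fun i => #|reach i|) i1C.
have back j : connect (Defs.arc Q) i j -> connect (Defs.arc Q) j i.
  move=> ij; have sub : reach j \subset reach i.
    by apply/fintype.subsetP => l; rewrite !inE; exact: connect_trans.
  have /eqP e : reach j == reach i.
    by rewrite eqEcard sub imin//; exact: Cf iC ij.
  by have : i \in reach i by [rewrite inE connect0]; rewrite -e inE.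
suff e : C0 = reach i.
  have : j0 \in C0 by rewrite C0E inE connect0.
  by rewrite e inE; exact: Cf.
apply: C0u; split.
  exists i; apply/setP => j; rewrite !inE.
  by apply/idP/andP => [ij|[]//]; split => //; exact: back.
by move=> l j; rewrite !inE; exact: connect_trans.
Qed.

End ClosedSets.

Section Products.
Context {R : realType} {n : nat} (G : game R n) (theta : R).
Hypotheses (th0 : 0 < theta) (th1 : theta < 1).

Definition damped_prod k (s : 'I_k -> min_policy G * max_policy G) : 'M[R]_n :=
  \big[mulmx/1%:M]_(l < k) damped_mx theta (s l).1 (s l).2.

Lemma damped_mxE (sigma : min_policy G) (tau : max_policy G) i j :
  damped_mx theta sigma tau i j =
  theta * (i == j)%:R + (1 - theta) * trans G (sigma i) (tau i) j.
Proof. by rewrite !mxE mulr_natr. Qed.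

Lemma damped_mx_ge0 (sigma : min_policy G) (tau : max_policy G) i j :
  0 <= damped_mx theta sigma tau i j.
Proof.
rewrite damped_mxE addr_ge0// mulr_ge0// ?ler0n ?trans_ge0 ?(ltW th0)//.
by rewrite subr_ge0 ltW.
Qed.

Lemma damped_mx_sum (sigma : min_policy G) (tau : max_policy G) i :
  \sum_j damped_mx theta sigma tau i j = 1.
Proof.
under eq_bigr do rewrite damped_mxE.
rewrite big_split/= -!mulr_sumr trans_sum1.
rewrite (bigD1 i)//= eqxx big1 => [|j]; last by rewrite eq_sym => /negbTE->.
by rewrite addr0 !mulr1 addrC subrK.
Qed.

Lemma damped_mx_diag (sigma : min_policy G) (tau : max_policy G) i :
  0 < damped_mx theta sigma tau i i.
Proof.
rewrite damped_mxE eqxx mulr1 ltr_pwDl// mulr_ge0 ?trans_ge0//.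
by rewrite subr_ge0 ltW.
Qed.

Lemma damped_mx_arc (sigma : min_policy G) (tau : max_policy G) i j :
  0 < policy_mx sigma tau i j -> 0 < damped_mx theta sigma tau i j.
Proof.
rewrite mxE => P0; rewrite damped_mxE ltr_wpDl ?mulr_ge0 ?ler0n ?(ltW th0)//.
by rewrite mulr_gt0// subr_gt0.
Qed.

Lemma damped_prodS k (s : 'I_k.+1 -> min_policy G * max_policy G) :
  damped_prod s = damped_prod (fun l => s (widen_ord (leqnSn k) l)) *m
    damped_mx theta (s ord_max).1 (s ord_max).2.
Proof. exact: (@big_ord_recr 'M[R]_n 1 *%R). Qed.

Lemma damped_prod_ge0 k (s : 'I_k -> min_policy G * max_policy G) i j :
  0 <= damped_prod s i j.
Proof.
elim: k s j => [|k IH] s j; first by rewrite /damped_prod big_ord0 mxE ler0n.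
by rewrite damped_prodS mxE sumr_ge0// => l _; rewrite mulr_ge0// damped_mx_ge0.
Qed.

Lemma damped_prod_sum k (s : 'I_k -> min_policy G * max_policy G) i :
  \sum_j damped_prod s i j = 1.
Proof.
elim: k s => [|k IH] s.
  rewrite /damped_prod big_ord0 (bigD1 i)//= big1 ?addr0 => [|j].
    by rewrite mxE eqxx.
  by rewrite mxE eq_sym => /negbTE->.
rewrite damped_prodS.
under eq_bigr do rewrite mxE.
rewrite exchange_big/=.
under eq_bigr do rewrite -mulr_sumr damped_mx_sum mulr1.
exact: IH.
Qed.

Definition support (Q : 'M[R]_n) i : {set 'I_n} := [set j | 0 < Q i j]%SET.

Lemma support_step (A : 'M[R]_n) (sigma : min_policy G) (tau : max_policy G)
    i j l : (forall i' j', 0 <= A i' j') ->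
  j \in support A i -> 0 < damped_mx theta sigma tau j l ->
  l \in support (A *m damped_mx theta sigma tau) i.
Proof.
move=> A0; rewrite !inE => Aj Ql; rewrite mxE (bigD1 j)//=.
rewrite ltr_pwDl ?mulr_gt0// sumr_ge0// => i' _.
by rewrite mulr_ge0// damped_mx_ge0.
Qed.

(** The diagonals are positive, so the support of a row never shrinks along a
    product. If neither support grew at a step, both would be closed for the
    policies of that step, and both would contain a state met by every closed
    set. *)
Lemma support_disjoint k (s : 'I_k -> min_policy G * max_policy G) i1 i2 :
  unichain_game G ->
  [disjoint support (damped_prod s) i1 & support (damped_prod s) i2] ->
  (k + 2 <= #|support (damped_prod s) i1| + #|support (damped_prod s) i2|)%N.
Proof.
move=> uni; elim: k s => [|k IH] s.
  move=> _; rewrite /damped_prod big_ord0.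
  have h i : (0 < #|support 1%:M i|)%N.
    by apply/card_gt0P; exists i; rewrite inE mxE eqxx.
  by have := h i1; have := h i2; lia.
rewrite damped_prodS; set s' := fun l => _; set st := s ord_max => dis.
set A := damped_prod s'; set Q := damped_mx _ _ _.
have A0 : forall i j, 0 <= A i j by exact: damped_prod_ge0.
have sub i : support A i \subset support (A *m Q) i.
  apply/fintype.subsetP => j jA; apply: (support_step A0 jA).
  exact: damped_mx_diag.
have disA : [disjoint support A i1 & support A i2].
  exact: disjointWl (sub i1) (disjointWr (sub i2) dis).
have le0 := IH _ disA; rewrite -/A in le0.
have le1 := subset_leq_card (sub i1); have le2 := subset_leq_card (sub i2).
have [j rec] := unichain_recurrent (uni st.1 st.2).
have closed i : #|support A i| = #|support (A *m Q) i| -> j \in support A i.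
  move=> e; have eS : support A i = support (A *m Q) i.
    by apply/eqP; rewrite eqEcard sub/= e.
  apply: rec; last first.
    apply: final_set_arc => i' j' i'A /damped_mx_arc arc.
    by rewrite eS; exact: support_step arc.
  have [j' jA] : exists j', 0 < A i j'.
    apply/not_existsP => none; have := damped_prod_sum s' i.
    rewrite -/A big1; first by move/eqP; rewrite eq_sym oner_eq0.
    by move=> j' _; apply/eqP; rewrite eq_le A0 andbT leNgt; apply/negP/none.
  by apply/set0Pn; exists j'; rewrite inE.
have [e1|] := eqVneq #|support A i1| #|support (A *m Q) i1|; last by lia.
have [e2|] := eqVneq #|support A i2| #|support (A *m Q) i2|; last by lia.
by move: disA => /pred0P/(_ j)/=; rewrite !closed.
Qed.

Lemma scrambling_exists : unichain_game G -> exists k, scrambling G theta k.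
Proof.
move=> uni; exists n => i1 i2 s Q.
have [dis|/pred0Pn[j /andP[]]] :=
  boolP [disjoint support (damped_prod s) i1 & support (damped_prod s) i2].
  have := support_disjoint uni dis; rewrite -cardsUI.
  move: dis; rewrite -setI_eq0 => /eqP->; rewrite cards0 addn0.
  by move=> le; have := leq_trans le (max_card _); rewrite card_ord; lia.
by rewrite /= !inE => ? ?; exists j.
Qed.

Lemma unichain_indexP : unichain_game G ->
  scrambling G theta (unichain_index G theta).
Proof.
move=> uni; have [k0 k0s] := scrambling_exists uni.
have ex : exists k, `[< scrambling G theta k >] by exists k0; apply/asboolP.
case: (ex_minnP ex) => k /asboolP ks kmin.
rewrite /unichain_index; case: xgetP => [k1 _ []//|/(_ k)[]].
by split => // k' /asboolP; exact: kmin.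
Qed.

Lemma scrambling_gt0 k (i1 i2 : 'I_n) :
  i1 != i2 -> scrambling G theta k -> (0 < k)%N.
Proof.
case: k => // ne sc.
have tau0 : min_policy G * max_policy G.
  split=> i; last by have /card_gt0P/cid[b] := maxact_gt0 G i.
  by have /card_gt0P/cid[b] := minact_gt0 G i.
have [j] := sc i1 i2 (fun=> tau0); rewrite big_ord0 !mxE => -[].
have [<-|] := eqVneq i1 j; last by rewrite ltxx.
by rewrite eq_sym (negbTE ne) ltxx.
Qed.

End Products.

(** * Contraction in Hilbert's seminorm, and inexact iterations *)

Section StochasticRows.
Context {R : realType} {n : nat}.

Lemma row_average_le (w z : 'I_n -> R) j c t :
  (forall l, 0 <= w l) -> \sum_l w l = 1 -> c <= w j -> (forall l, z l <= t) ->
  \sum_l w l * z l <= c * z j + (1 - c) * t.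
Proof.
move=> w0 w1 cj zt.
have -> : 1 - c = w j - c + \sum_(l | l != j) w l.
  by rewrite -w1 (bigD1 j)//=; ring.
rewrite (bigD1 j)//= mulrDl mulr_suml addrA lerD ?ler_sum//.
  have := ler_wpM2l (_ : 0 <= w j - c) (zt j); rewrite subr_ge0 => /(_ cj); lra.
by move=> l _; rewrite ler_wpM2l.
Qed.

(** Both rows put weight c on the column j, where their contributions cancel;
    only the remaining weight 1 - c can spread the values of z. *)
Lemma stochastic_span (Q : 'M[R]_n) (z : 'cV[R]_n) i1 i2 j c :
  (forall i l, 0 <= Q i l) -> (forall i, \sum_l Q i l = 1) ->
  c <= Q i1 j -> c <= Q i2 j ->
  (Q *m z) i1 0 - (Q *m z) i2 0 <= (1 - c) * hilbert_seminorm z.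
Proof.
move=> Q0 Q1 c1 c2; rewrite !mxE.
have up := row_average_le (Q0 i1) (Q1 i1) c1 (top_ge z).
have bz l : - z l 0 <= - bot z by rewrite lerN2; exact: bot_le.
have := row_average_le (Q0 i2) (Q1 i2) c2 bz.
under eq_bigr do rewrite mulrN.
rewrite sumrN /hilbert_seminorm; lra.
Qed.

End StochasticRows.

Section Contraction.
Context {R : realType} {n : nat} (G : game R n) (theta : R).
Hypotheses (th0 : 0 < theta) (th1 : theta < 1).
Hypothesis theta_le : forall i (a : minact G i) (b : maxact G i) j,
  i != j -> 0 < trans G a b j -> theta <= (1 - theta) * trans G a b j.

(** This is where the choice of theta enters: it balances the diagonal entries,
    at least theta, with the smallest damped off-diagonal ones. *)
Lemma damped_mx_ge (sigma : min_policy G) (tau : max_policy G) i j :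
  0 < damped_mx theta sigma tau i j -> theta <= damped_mx theta sigma tau i j.
Proof.
rewrite damped_mxE; have [<-|ne] := eqVneq i j.
  by rewrite mulr1 lerDl mulr_ge0 ?trans_ge0// subr_ge0 ltW.
by rewrite mulr0 add0r pmulr_rgt0 ?subr_gt0//; exact: theta_le.
Qed.

Lemma damped_prod_ge k (s : 'I_k -> min_policy G * max_policy G) i j :
  0 < damped_prod theta s i j -> theta ^+ k <= damped_prod theta s i j.
Proof.
elim: k s j => [|k IH] s j.
  by rewrite /damped_prod big_ord0 mxE; case: eqP => //; rewrite ltxx.
rewrite damped_prodS; set A := damped_prod _ _; set Q := damped_mx _ _ _.
have A0 : forall i j, 0 <= A i j by exact: damped_prod_ge0.
have Q0 : forall i j, 0 <= Q i j by exact: damped_mx_ge0.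
rewrite mxE => pos.
have [l Al Ql] : exists2 l, 0 < A i l & 0 < Q l j.
  apply: contrapT => none; move: pos; rewrite big1 ?ltxx// => l _.
  have [->|Al] := eqVneq (A i l) 0; first by rewrite mul0r.
  have [->|Ql] := eqVneq (Q l j) 0; first by rewrite mulr0.
  by case: none; exists l; rewrite lt_def ?Al ?Ql ?A0 ?Q0.
rewrite (bigD1 l)//= exprSr -[leLHS]addr0 lerD ?sumr_ge0//.
  by rewrite ler_pM ?exprn_ge0 ?(ltW th0)//; [exact: IH|exact: damped_mx_ge].
by move=> i' _; rewrite mulr_ge0.
Qed.

(** The property of Shapley operators that the contraction argument uses.
    Exchanging x and y turns the upper bound into a lower one, so it is enough
    to ask for one of them. It is shared by the operators of the game in which
    the policy of one player is fixed. *)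
Definition dominated (S : 'cV[R]_n -> 'cV[R]_n) : Prop := forall x y i,
  exists (a : minact G i) (b : maxact G i),
    S x i 0 - S y i 0 <= \sum_j trans G a b j * (x j 0 - y j 0).

Definition damp (S : 'cV[R]_n -> 'cV[R]_n) x := theta *: x + (1 - theta) *: S x.

Variable S : 'cV[R]_n -> 'cV[R]_n.
Hypothesis domS : dominated S.
Let F := damp S.

(** One pair of pure policies serves all coordinates at once: the sign of the
    coefficient of u decides whether the upper or the lower row is taken. *)
Lemma damp_dominated x y (u : 'rV[R]_n) :
  exists (sigma : min_policy G) (tau : max_policy G),
    (u *m (F x - F y)) 0 0 <= (u *m (damped_mx theta sigma tau *m (x - y))) 0 0.
Proof.
have pick i : exists ab : minact G i * maxact G i,
    u 0 i * (F x - F y) i 0 <= u 0 i *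
    (theta * (x - y) i 0 +
     (1 - theta) * \sum_j trans G ab.1 ab.2 j * (x - y) j 0).
  have t1 : 0 <= 1 - theta by rewrite subr_ge0 ltW.
  have -> : (F x - F y) i 0 =
      theta * (x i 0 - y i 0) + (1 - theta) * (S x i 0 - S y i 0).
    by rewrite !mxE; ring.
  have [u0|u0] := leP 0 (u 0 i).
    have [a [b ab]] := domS x y i; exists (a, b) => /=.
    rewrite ler_wpM2l// !mxE lerD2l ler_wpM2l//; under eq_bigr do rewrite !mxE.
    exact: ab.
  have [a [b ab]] := domS y x i; exists (a, b) => /=.
  rewrite ler_wnM2l ?(ltW u0)// !mxE lerD2l ler_wpM2l// -lerN2 opprB.
  rewrite (le_trans ab)// -sumrN; apply: ler_sum => j _.
  by rewrite !mxE -mulrN opprB.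
exists (fun i => (projT1 (cid (pick i))).1),
  (fun i => (projT1 (cid (pick i))).2).
rewrite mxE [leRHS]mxE; apply: ler_sum => i _.
apply: (le_trans (projT2 (cid (pick i)))); set ab := projT1 _.
rewrite le_eqVlt; apply/orP; left; apply/eqP; congr (_ * _).
rewrite [RHS]mxE; under [RHS]eq_bigr do rewrite damped_mxE mulrDl.
rewrite big_split/= mulr_sumr; congr (_ + _); last first.
  by apply: eq_bigr => j _; ring.
rewrite (bigD1 i)//= eqxx mulr1 big1 ?addr0// => j; rewrite eq_sym => /negbTE->.
by rewrite mulr0 mul0r.
Qed.

Lemma iter_dominated k x y (u : 'rV[R]_n) :
  exists s : 'I_k -> min_policy G * max_policy G,
    (u *m (iter k F x - iter k F y)) 0 0 <=
    (u *m (damped_prod theta s *m (x - y))) 0 0.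
Proof.
elim: k u => [|k IH] u.
  have [sigma [tau _]] := damp_dominated x y u.
  by exists (fun=> (sigma, tau)); rewrite /damped_prod big_ord0 mul1mx.
have [sigma [tau st]] := damp_dominated (iter k F x) (iter k F y) u.
have [s hs] := IH (u *m damped_mx theta sigma tau).
exists (fun l => if unlift ord0 l is Some l' then s l' else (sigma, tau)).
rewrite /damped_prod big_ord_recl unlift_none/=.
under eq_bigr do rewrite liftK.
by rewrite (le_trans st)// mulmxA (le_trans hs)// !mulmxA.
Qed.

Lemma delta_mulmx (v : 'cV[R]_n) i1 i2 :
  ((delta_mx 0 i1 - delta_mx 0 i2 : 'rV[R]_n) *m v) 0 0 = v i1 0 - v i2 0.
Proof. by rewrite mulmxBl -!rowE !mxE. Qed.

Lemma iter_nonexpansive k x y (i0 : 'I_n) :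
  hilbert_seminorm (iter k F x - iter k F y) <= hilbert_seminorm (x - y).
Proof.
apply: (hilbert_le i0) => i1 i2; rewrite -delta_mulmx.
have [s /le_trans->//] := iter_dominated k x y (delta_mx 0 i1 - delta_mx 0 i2).
have := @stochastic_span _ _ (damped_prod theta s) (x - y) i1 i2 i0 0.
rewrite subr0 mul1r delta_mulmx; apply=> *;
  by rewrite ?damped_prod_ge0 ?damped_prod_sum.
Qed.

Lemma iter_contraction k x y (i0 : 'I_n) : scrambling G theta k ->
  hilbert_seminorm (iter k F x - iter k F y) <=
  (1 - theta ^+ k) * hilbert_seminorm (x - y).
Proof.
move=> sc; apply: (hilbert_le i0) => i1 i2; rewrite -delta_mulmx.
have [s /le_trans->//] := iter_dominated k x y (delta_mx 0 i1 - delta_mx 0 i2).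
have [j [j1 j2]] := sc i1 i2 s.
rewrite delta_mulmx; apply: (@stochastic_span _ _ _ _ _ _ j) => *.
- exact: damped_prod_ge0.
- exact: damped_prod_sum.
- exact: damped_prod_ge.
- exact: damped_prod_ge.
Qed.

Section NoisyIteration.
Variables (X : nat -> 'cV[R]_n) (delta : R) (i0 : 'I_n).
Hypothesis noise : forall m, hilbert_seminorm (X m.+1 - F (X m)) <= delta.

Lemma noisy_iter m k :
  hilbert_seminorm (X (m + k) - iter k F (X m)) <= k%:R * delta.
Proof.
elim: k => [|k IH].
  rewrite addn0 /= subrr mul0r; apply: (hilbert_le i0) => i j.
  by rewrite !mxE subrr.
have -> : X (m + k.+1) - iter k.+1 F (X m) =
    (X (m + k).+1 - F (X (m + k))) +
    (iter 1 F (X (m + k)) - iter 1 F (iter k F (X m))).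
  by rewrite addnS /= addrA subrK.
rewrite (le_trans (hilbertD _ _ i0))// -natr1 mulrDl mul1r addrC lerD//.
exact: le_trans (iter_nonexpansive _ _ _ i0) IH.
Qed.

(** The increment X_(m+1+k) - X_(m+k) is compared with
    F^k X_(m+1) - F^k X_m; each of the two comparisons costs k delta. *)
Lemma noisy_increment k m : scrambling G theta k ->
  hilbert_seminorm (X (m + k).+1 - X (m + k)) <=
  (1 - theta ^+ k) * hilbert_seminorm (X m.+1 - X m) + 2 * k%:R * delta.
Proof.
move=> sc.
have -> : X (m + k).+1 - X (m + k) = (X (m.+1 + k) - iter k F (X m.+1)) +
    ((iter k F (X m.+1) - iter k F (X m)) + - (X (m + k) - iter k F (X m))).
  by rewrite opprB addrA subrKA addrA subrK.
have := hilbertD (X (m.+1 + k) - iter k F (X m.+1))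
    ((iter k F (X m.+1) - iter k F (X m)) + - (X (m + k) - iter k F (X m))) i0.
have := hilbertD (iter k F (X m.+1) - iter k F (X m))
  (- (X (m + k) - iter k F (X m))) i0.
rewrite hilbertN//.
have := noisy_iter m k; have := noisy_iter m.+1 k.
have := iter_contraction (X m.+1) (X m) i0 sc; lra.
Qed.

Lemma noisy_increments k q : scrambling G theta k -> 0 <= delta ->
  hilbert_seminorm (X (q * k).+1 - X (q * k)) <=
  (1 - theta ^+ k) ^+ q * hilbert_seminorm (X 1 - X 0) +
  2 * k%:R * delta * theta ^- k.
Proof.
move=> sc d0; have c0 : 0 < theta ^+ k by rewrite exprn_gt0.
have c1 : theta ^+ k <= 1 by rewrite exprn_ile1 ?ltW.
elim: q => [|q IH].
  by rewrite mul0n expr0 mul1r lerDl !mulr_ge0// invr_ge0 ltW.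
rewrite mulSn addnC (le_trans (noisy_increment _ sc))//.
have t : 0 <= 1 - theta ^+ k by rewrite subr_ge0.
rewrite (le_trans (lerD (ler_wpM2l t IH) (lexx _)))// exprS.
set D := hilbert_seminorm _; set c := theta ^+ k in c0 c1 t *.
rewrite le_eqVlt; apply/orP; left; apply/eqP; field.
by rewrite gt_eqF.
Qed.

End NoisyIteration.
End Contraction.

(** * Integer invariant vectors of rational unichain matrices *)

Section Determinant.
Context {R : realFieldType}.

(** Elimination of the first column by the pivot A 0 0. *)
Lemma det_schur m (A : 'M[R]_(1 + m)) : A 0 0 != 0 ->
  \det A = A 0 0 * \det (\matrix_(i < m, j < m)
    (A (rshift 1 i) (rshift 1 j) -
     A (rshift 1 i) 0 * A 0 (rshift 1 j) / A 0 0)).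
Proof.
move=> a0; set a := A 0 0 in a0 *; set B := \matrix_(i, j) _.
have l0 : lshift m (0 : 'I_1) = 0 by apply/val_inj.
have -> : A = block_mx 1%:M 0 (a^-1 *: dlsubmx A) 1%:M *m
              block_mx a%:M (ursubmx A) 0 B.
  rewrite mulmx_block !mul0mx !mulmx0 !mul1mx !addr0 ?add0r -[LHS]submxK.
  congr block_mx; apply/matrixP => i j; rewrite !mxE ?big_ord1 ?ord1 ?mxE ?l0.
  - by rewrite eqxx.
  - by rewrite eqxx mulr1n mulrC mulrA mulfV// mul1r.
  - by rewrite addrC -mulrA mulrCA mulrC -addrA addrC; ring.
by rewrite det_mulmx det_lblock det_ublock !det1 !mul1r det_scalar1.
Qed.

Lemma dominant_diag_ge0 m (A : 'M[R]_m) i :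
  (forall j, i != j -> A i j <= 0) -> 0 <= \sum_j A i j -> 0 <= A i i.
Proof.
move=> off; rewrite (bigD1 i)//= => /le_trans; apply; rewrite gerDl sumr_le0//.
by move=> j; rewrite eq_sym; exact: off.
Qed.

(** A Schur complement of a row diagonally dominant matrix with nonpositive
    off-diagonal entries is again of this kind, and its diagonal entries have
    not increased. *)
Lemma det_dominant m (A : 'M[R]_m) :
  (forall i j, i != j -> A i j <= 0) -> (forall i, 0 <= \sum_j A i j) ->
  0 <= \det A <= \prod_i A i i.
Proof.
elim: m A => [|m IH] A off row.
  by rewrite det_mx00 big_ord0 ler01 lexx.
rewrite -[m.+1]/(1 + m)%N in A off row *.
have l0 : lshift m (0 : 'I_1) = 0 by apply/val_inj.
have row_split i : \sum_j A i j = A i 0 + \sum_j A i (rshift 1 j).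
  by rewrite big_split_ord/= big_ord1 l0.
have off0 j : A 0 (rshift 1 j) <= 0 by exact: off.
have off1 i : A (rshift 1 i) 0 <= 0 by exact: off.
have a0 : 0 <= A 0 0 by apply: (dominant_diag_ge0 (off 0)).
rewrite (@big_split_ord _ _ _ 1 m)/= big_ord1 l0.
(* A zero pivot forces the whole first row to vanish. *)
have [a_eq0|an0] := eqVneq (A 0 0) 0.
  have z j : A 0 (rshift 1 j) = 0.
    apply/eqP; rewrite eq_le off0/=.
    have := row 0; rewrite row_split a_eq0 add0r (bigD1 j)//=.
    move=> /le_trans; apply.
    by rewrite gerDl sumr_le0.
  rewrite a_eq0 mul0r (expand_det_row A 0) (@big_split_ord _ _ _ 1 m)/=.
  rewrite big_ord1 l0.
  rewrite a_eq0 mul0r big1 ?addr0 ?lexx// => j _.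
  by rewrite z mul0r.
have ap : 0 < A 0 0 by rewrite lt_def an0.
rewrite det_schur//; set B := \matrix_(i, j) _.
have corr i j : 0 <= A (rshift 1 i) 0 * A 0 (rshift 1 j) / A 0 0.
  by rewrite mulr_ge0 ?invr_ge0 ?mulr_le0.
have offB i j : i != j -> B i j <= 0.
  move=> ij; rewrite mxE subr_le0; apply: le_trans (corr i j); apply: off.
  by apply: contra ij => /eqP/rshift_inj->.
(* The i-th row sum of B is that of A minus A i 0 (1 + s0 / A 0 0). *)
have rowB i : 0 <= \sum_j B i j.
  under eq_bigr do rewrite mxE.
  rewrite sumrB -mulr_suml -mulr_sumr.
  have r0 := row 0; have ri := row (rshift 1 i).
  rewrite !row_split in r0 ri.
  set s0 := \sum_j A 0 _ in r0 *; set si := \sum_j _ in ri *.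
  have : 0 <= - A (rshift 1 i) 0 * (A 0 0 + s0) / A 0 0.
    by rewrite !mulr_ge0 ?invr_ge0// oppr_ge0.
  have -> : - A (rshift 1 i) 0 * (A 0 0 + s0) / A 0 0 =
    - A (rshift 1 i) 0 - A (rshift 1 i) 0 * s0 / A 0 0 by field.
  lra.
have /andP[d0 d1] := IH B offB rowB.
rewrite mulr_ge0//= ler_wpM2l// (le_trans d1)//.
apply: ler_prod => i _; rewrite (dominant_diag_ge0 (offB i))//=.
by rewrite mxE lerBlDr lerDl.
Qed.

End Determinant.

Section InvariantVector.
Context {R : realType} {n : nat} (P : 'M[R]_n) (M : nat).
Hypotheses (P0 : forall i j, 0 <= P i j) (P1 : forall i, \sum_j P i j = 1).
Hypothesis uni : unichain P.

(** Maximum principle: if the maximum were positive, the states attaining it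
    would form a closed set that misses j. *)
Lemma harmonic_le0 (j : 'I_n) (y : 'I_n -> R) :
  (forall C, C != finset.set0 -> final_set P C -> j \in C) ->
  y j = 0 -> (forall i, i != j -> y i = \sum_l P i l * y l) ->
  forall i, y i <= 0.
Proof.
move=> rec yj harm i.
pose t := fmax predT y.
have yt l : y l <= t by exact: fmax_ge.
have [i0 _ ti0] := @fmax_attained _ _ predT y i isT; rewrite -/t in ti0.
rewrite (le_trans (yt i))// leNgt; apply/negP => t0.
have jt : y j != t by rewrite yj lt_eqF.
have : j \in [set l | y l == t]%SET.
  apply: rec; first by apply/set0Pn; exists i0; rewrite inE ti0.
  apply: final_set_arc => l l'; rewrite !inE => /eqP yl Pll.
  have lj : l != j by apply: contra jt => /eqP <-; rewrite yl.
  have e : \sum_m P l m * (t - y m) = 0.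
    under eq_bigr do rewrite mulrBr.
    by rewrite sumrB -mulr_suml P1 mul1r -harm// yl subrr.
  have ge0 m : true -> 0 <= P l m * (t - y m) by rewrite mulr_ge0// subr_ge0.
  have /eqP := @psumr_eq0P _ _ _ _ ge0 e l' isT.
  by rewrite mulf_eq0 gt_eqF//= subr_eq0 eq_sym.
by rewrite inE (negbTE jt).
Qed.

Lemma harmonic_eq0 (j : 'I_n) (y : 'I_n -> R) :
  (forall C, C != finset.set0 -> final_set P C -> j \in C) ->
  y j = 0 -> (forall i, i != j -> y i = \sum_l P i l * y l) ->
  forall i, y i = 0.
Proof.
move=> rec yj harm i; apply/eqP; rewrite eq_le (harmonic_le0 rec)//=.
rewrite -oppr_le0 (harmonic_le0 (y := fun l => - y l) rec) ?yj ?oppr0//.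
move=> l lj; rewrite harm// -sumrN; apply: eq_bigr => m _; ring.
Qed.

Hypothesis M0 : (0 < M)%N.
Hypothesis rational : forall i j, exists m : int, P i j = m%:~R / M%:R.

Let MR : (0 : R) < M%:R. Proof. by rewrite ltr0n. Qed.

Definition scaled_laplacian : 'M[R]_n :=
  \matrix_(i, j) (M%:R * ((i == j)%:R - P i j)).
Let A := scaled_laplacian.

Lemma laplacian_off i j : i != j -> A i j <= 0.
Proof.
by move=> /negbTE ij; rewrite mxE ij sub0r pmulr_rle0// oppr_le0.
Qed.

Lemma laplacian_row i : \sum_j A i j = 0.
Proof.
under eq_bigr do rewrite mxE.
rewrite -mulr_sumr sumrB P1 (bigD1 i)//= eqxx big1 => [|j].
  by rewrite addr0 subrr mulr0.
by rewrite eq_sym => /negbTE->.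
Qed.

Lemma laplacian_harmonic (y : 'I_n -> R) i :
  \sum_m A i m * y m = 0 -> y i = \sum_m P i m * y m.
Proof.
under eq_bigr do rewrite mxE -mulrA mulrBl.
rewrite -mulr_sumr sumrB => /eqP.
rewrite mulf_eq0 gt_eqF//= subr_eq0 => /eqP <-.
rewrite (bigD1 i)//= eqxx mul1r big1 ?addr0// => m.
by rewrite eq_sym => /negbTE->; rewrite mul0r.
Qed.

Lemma laplacian_integral : exists A0 : 'M[int]_n, A = map_mx intr A0.
Proof.
exists (\matrix_(i, j) ((i == j)%:R * M%:R - projT1 (cid (rational i j)))).
apply/matrixP => i j; rewrite !mxE; case: cid => m /= ->.
have Mne : (M%:R : R) != 0 by rewrite gt_eqF.
by rewrite rmorphB rmorphM/= !rmorph_nat; field.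
Qed.

Definition minor j : R := \det (row' j (col' j A)).

Lemma minor_bounds j : 0 <= minor j <= M%:R ^+ (n - 1).
Proof.
have off i l : i != l -> row' j (col' j A) i l <= 0.
  by move=> il; rewrite mxE mxE laplacian_off// (inj_eq lift_inj).
have row i : 0 <= \sum_l row' j (col' j A) i l.
  have := laplacian_row (lift j i); rewrite (bigD1_ord j)//= => sum0.
  have := laplacian_off (_ : lift j i != j).
  rewrite eq_sym neq_lift => /(_ isT).
  have -> : \sum_l row' j (col' j A) i l = \sum_l A (lift j i) (lift j l).
    by apply: eq_bigr => l _; rewrite mxE mxE.
  by move/eqP: sum0; rewrite addrC addr_eq0 => /eqP->; rewrite oppr_ge0.
have /andP[-> /le_trans->//] := det_dominant off row.
rewrite subn1 -[X in _ ^+ X]card_ord -prodr_const; apply: ler_prod => i _.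
rewrite (dominant_diag_ge0 (off i))//= !mxE eqxx -[leRHS]mulr1 ler_wpM2l//.
by rewrite gerBl.
Qed.

(** A kernel vector of the principal submatrix, extended by 0 at j, is harmonic
    off j. *)
Lemma minor_neq0 j :
  (forall C, C != finset.set0 -> final_set P C -> j \in C) -> minor j != 0.
Proof.
move=> rec; rewrite /minor -det_tr; apply/det0P => -[v v0 vB].
pose y l := if unlift j l is Some l' then v 0 l' else 0.
have yl i : y (lift j i) = v 0 i by rewrite /y liftK.
have yz : forall i, y i = 0.
  apply: (harmonic_eq0 rec); first by rewrite /y unlift_none.
  move=> i; rewrite eq_sym => /unlift_some[i' -> _].
  move/matrixP/(_ 0 i'): vB; rewrite !mxE => vB.
  apply: laplacian_harmonic.
  rewrite (bigD1_ord j)//= {1}/y unlift_none mulr0 add0r -[RHS]vB.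
  by apply: eq_bigr => l _; rewrite yl mulrC !mxE.
case/eqP: v0; apply/rowP => i; rewrite mxE -yl; exact: yz.
Qed.

(** The adjugate of the Laplacian A satisfies A adj(A) = adj(A) A = 0. By the
    first equation its columns are harmonic, hence constant, so that each of
    its rows lists the principal minors; by the second these are an invariant
    vector, nonzero at a recurrent state. (Matrix-tree theorem for Markov
    chains.) *)
Lemma integer_invariant_vector : exists w : 'I_n -> int,
  [/\ forall j, 0 <= w j <= (M ^ (n - 1))%:Z, 0 < \sum_j w j &
      forall i, \sum_l (w l)%:~R * P l i = (w i)%:~R].
Proof.
have [j rec] := unichain_recurrent uni.
have [A0 AE] := laplacian_integral.
have minorE l : \adj A l l = minor l.
  by rewrite mxE /cofactor -signr_odd addnn odd_double expr0 mul1r.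
pose e : 'cV[R]_n := const_mx 1.
have Ae : A *m e = 0.
  apply/colP => i; rewrite !mxE -[RHS](laplacian_row i); apply: eq_bigr => l _.
  by rewrite [e _ _]mxE mulr1.
have det0 : \det A = 0.
  rewrite -det_tr; apply/eqP/det0P; exists e^T.
    by apply/negP => /eqP/rowP/(_ j); rewrite !mxE => /eqP; rewrite oner_eq0.
  by rewrite -trmx_mul Ae trmx0.
have AadjA : A *m \adj A = 0 by rewrite mul_mx_adj det0 raddf0.
have adjAA : \adj A *m A = 0 by rewrite mul_adj_mx det0 raddf0.
have col_const i l : \adj A i l = \adj A j l.
  apply/eqP; rewrite -subr_eq0; apply/eqP; move: i.
  apply: (harmonic_eq0 rec); first by rewrite subrr.
  move=> i _.
  apply: (@laplacian_harmonic (fun m => \adj A m l - \adj A j l)).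
  under eq_bigr do rewrite mulrBr.
  rewrite sumrB -mulr_suml laplacian_row mul0r subr0.
  by move/matrixP/(_ i l): AadjA; rewrite mxE [RHS]mxE.
exists (fun l => \adj A0 l l).
have adjE i l : (\adj A0 i l)%:~R = \adj A i l.
  by rewrite AE -map_mx_adj [RHS]mxE.
have bounds l : 0 <= \adj A0 l l <= (M ^ (n - 1))%:Z.
  by rewrite -!(ler_int R) adjE minorE -pmulrn natrX; exact: minor_bounds.
split=> //.
  rewrite (bigD1 j)//= ltr_pwDl ?sumr_ge0// => [|l _].
    rewrite lt_def; have /andP[-> _] := bounds j; rewrite andbT.
    by rewrite -(intr_eq0 R) adjE minorE minor_neq0.
  by have /andP[] := bounds l.
move=> i; under eq_bigr do rewrite adjE col_const.
have : \sum_l \adj A j l * A l i = 0.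
  by move/matrixP/(_ j i): adjAA; rewrite mxE [RHS]mxE.
under [in X in X = 0 -> _]eq_bigr do rewrite [A _ _]mxE mulrCA mulrBr.
rewrite -mulr_sumr sumrB => /eqP.
rewrite mulf_eq0 gt_eqF//= subr_eq0 => /eqP <-.
rewrite (bigD1 i)//= eqxx mulr1 big1 => [|m /negbTE->]; last by rewrite mulr0.
by rewrite addr0 adjE -(col_const i).
Qed.

End InvariantVector.

(** * Long-run average payments of plays *)

Lemma big_tuple_cons (R : realType) (T : finType) N (F : seq T -> R) :
  \sum_(w : N.+1.-tuple T) F w = \sum_(s : T) \sum_(w : N.-tuple T) F (s :: w).
Proof.
rewrite pair_bigA.
rewrite (reindex (fun p : T * N.-tuple T => [tuple of p.1 :: p.2]))//=.
exists (fun w => (thead w, [tuple of behead w])) => [[s w] _|w _] /=.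
  by congr (_, _); apply/val_inj.
by rewrite [RHS]tuple_eta.
Qed.

Section LimitSuperior.
Context {R : realType}.
Implicit Types (u : nat -> R) (c K : R).

Lemma limn_esup_le u c K : (forall N, (0 < N)%N -> u N <= c + K / N%:R) ->
  (limn_esup (fun N => (u N)%:E) <= c%:E)%E.
Proof.
move=> uc; apply/lee_addgt0Pr => e e0; rewrite -EFinD.
(* From N0 on, K / N is at most e. *)
pose N0 := (Num.truncn (`|K| / e)).+1.
have tail : (\oo)%classic [set N | (N0 <= N)%N]%classic by exists N0.
apply: le_trans (ereal_inf_lbound _) _.
  by exists [set N | (N0 <= N)%N]%classic.
apply: ub_ereal_sup => _ [N /= N0N <-]; rewrite lee_fin.
have N1 : (0 < N)%N by apply: leq_trans N0N.
have NR : 0 < N%:R :> R by rewrite ltr0n.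
rewrite (le_trans (uc N N1))// lerD2l ler_pdivrMr//.
rewrite (le_trans (ler_norm K))// mulrC -ler_pdivrMr//.
by rewrite (le_trans (ltW (truncnS_gt _)))// ler_nat.
Qed.

Lemma limn_einf_ge u c K : (forall N, (0 < N)%N -> c - K / N%:R <= u N) ->
  (c%:E <= limn_einf (fun N => (u N)%:E))%E.
Proof.
move=> uc; rewrite /limn_einf leeNr -EFinN.
apply: (@limn_esup_le (fun N => - u N) _ K) => N N0.
by rewrite -lerN2 opprD !opprK uc.
Qed.

End LimitSuperior.

Section Plays.
Context {R : realType} {n : nat} (G : game R n).
Variables (sigma : min_strategy G) (tau : max_strategy G).
Implicit Types (h : seq (stage G)) (mu v : 'I_n -> R) (f : stage G -> R).

Definition action_prob h (s : stage G) : R :=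
  sigma h (stage_state s) (stage_min s) * tau h (stage_state s) (stage_max s).

Definition expected_sum f N h mu : R :=
  \sum_(w : N.-tuple (stage G)) play_prob sigma tau h mu w * \sum_(s <- w) f s.

Lemma action_prob_ge0 h s : 0 <= action_prob h s.
Proof. by rewrite mulr_ge0// fdist_ge0. Qed.

Lemma stage_average h mu v :
  \sum_s mu (stage_state s) * action_prob h s * v (stage_state s) =
  \sum_i mu i * v i.
Proof.
rewrite (reindex_onto (fun s : stage G => s) id)//=.
transitivity (\sum_i \sum_(ab : minact G i * maxact G i)
    mu i * (sigma h i ab.1 * tau h i ab.2) * v i).
  by rewrite sig_big_dep/=; apply: eq_bigl => s; rewrite eqxx.
apply: eq_bigr => i _.
rewrite -mulr_suml -mulr_sumr.
rewrite -(pair_bigA _ (fun a b => sigma h i a * tau h i b))/=.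
under eq_bigr do rewrite -mulr_sumr fdist_sum1 mulr1.
by rewrite fdist_sum1 mulr1.
Qed.

Lemma play_mass N h mu : \sum_i mu i = 1 ->
  \sum_(w : N.-tuple (stage G)) play_prob sigma tau h mu w = 1.
Proof.
elim: N h mu => [|N IH] h mu mu1.
  rewrite (eq_bigr (fun=> 1)) => [|w _]; last by rewrite tuple0.
  by rewrite sumr_const card_tuple expn0.
rewrite (@big_tuple_cons _ _ N (play_prob sigma tau h mu)) /=.
under eq_bigr do rewrite -mulr_sumr IH ?trans_sum1//.
have := stage_average h mu (fun=> 1).
by under [in RHS]eq_bigr do rewrite mulr1; rewrite mu1.
Qed.

Lemma expected_sumS f N h mu : expected_sum f N.+1 h mu =
  \sum_s mu (stage_state s) * action_prob h s *
    (f s + expected_sum f N (rcons h s) (stage_trans s)).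
Proof.
rewrite /expected_sum (@big_tuple_cons _ _ N
  (fun w => play_prob sigma tau h mu w * \sum_(s <- w) f s)).
apply: eq_bigr => s _ /=.
rewrite -[f s]mul1r -(@play_mass N (rcons h s) (stage_trans s)); last first.
  exact: trans_sum1.
rewrite mulr_suml -big_split/= mulr_sumr; apply: eq_bigr => w _.
by rewrite big_cons -/(action_prob h s); ring.
Qed.

(** The accumulated payment plus the potential of the current state grows by at
    most c per stage in expectation, whatever the history. Only stages of
    positive probability matter, so a stationary policy of one player has to
    satisfy the inequality for its own actions only. *)
Lemma potential_bound f v c m :
  (forall i, m <= v i) ->
  (forall h s, action_prob h s != 0 ->
    f s + \sum_j stage_trans s j * v j <= v (stage_state s) + c) ->
  forall N h mu, (forall i, 0 <= mu i) -> \sum_i mu i = 1 ->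
  expected_sum f N h mu <= N%:R * c + (\sum_i mu i * v i - m).
Proof.
move=> vm step; elim=> [|N IH] h mu mu0 mu1.
  rewrite /expected_sum big1 => [|w _]; last by rewrite tuple0 big_nil mulr0.
  rewrite mul0r add0r subr_ge0 -[m]mul1r -mu1 mulr_suml.
  by apply: ler_sum => i _; rewrite ler_wpM2l.
rewrite expected_sumS.
have -> : N.+1%:R * c + (\sum_i mu i * v i - m) =
    \sum_s mu (stage_state s) * action_prob h s *
      (v (stage_state s) + (N.+1%:R * c - m)).
  rewrite (stage_average h mu (fun i => v i + (N.+1%:R * c - m))).
  under [RHS]eq_bigr do rewrite mulrDr.
  by rewrite big_split/= -[X in _ = _ + X]mulr_suml mu1; ring.
apply: ler_sum => s _.
have [->|p0] := eqVneq (action_prob h s) 0; first by rewrite mulr0 !mul0r.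
rewrite ler_wpM2l ?(mulr_ge0 (mu0 _) (action_prob_ge0 _ _))//.
have := IH (rcons h s) (stage_trans s) (trans_ge0 _ _) (trans_sum1 _ _).
have := step h s p0; rewrite -natr1; lra.
Qed.

End Plays.

Section LongRunAverage.
Context {R : realType} {n : nat} (G : game R n).
Implicit Types (sigma : min_policy G) (tau : max_policy G) (x : 'cV[R]_n).

Lemma point_mass_neq0 (T : finType) (t0 t : T) :
  point_mass (R := R) t0 t != 0 -> t = t0.
Proof. by case: (eqVneq t t0) => //= /negbTE->; rewrite eqxx. Qed.

Lemma point_mass_average i0 (v : 'I_n -> R) :
  \sum_i point_mass (R := R) i0 i * v i = v i0.
Proof.
rewrite (bigD1 i0)//= eqxx mul1r big1 ?addr0// => i /negbTE->.
by rewrite mul0r.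
Qed.

Lemma chi_sup_le sigma x c i0 (tau' : max_strategy G) :
  (forall i b, local_value x (sigma i) b <= x i 0 + c) ->
  (chi_sup i0 (min_stationary sigma) tau' <= c%:E)%E.
Proof.
move=> step.
apply: (@limn_esup_le _ _ c (x i0 0 - bot x)) => N N0.
have NR : 0 < N%:R :> R by rewrite ltr0n.
rewrite ler_pdivrMr// mulrDl mulfVK ?gt_eqF// mulrC.
have := @potential_bound _ _ G (min_stationary sigma) tau'
  (@stage_payment _ _ G) (fun i => x i 0) c (bot x) (bot_le x) _ N [::] _
  (fdist_ge0 _) (fdist_sum1 (point_mass i0)).
rewrite point_mass_average; apply => h [i [a b]].
rewrite /action_prob mulf_eq0 negb_or => /andP[/point_mass_neq0 + _].
rewrite /stage_payment /stage_trans /stage_min /stage_max /= => ->.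
exact: step.
Qed.

(** The bound of [potential_bound] for the opposite payments and potential. *)
Lemma chi_inf_ge tau x c i0 (sigma' : min_strategy G) :
  (forall i a, x i 0 + c <= local_value x a (tau i)) ->
  (c%:E <= chi_inf i0 sigma' (max_stationary tau))%E.
Proof.
move=> step.
apply: (@limn_einf_ge _ _ c (top x - x i0 0)) => N N0.
have NR : 0 < N%:R :> R by rewrite ltr0n.
rewrite ler_pdivlMr// mulrBl mulfVK ?gt_eqF// mulrC.
have := @potential_bound _ _ G sigma' (max_stationary tau)
  (fun s => - stage_payment s) (fun i => - x i 0) (- c) (- top x) _ _ N [::] _
  (fdist_ge0 _) (fdist_sum1 (point_mass i0)).
rewrite point_mass_average => bound.
have -> : expected_payment i0 sigma' (max_stationary tau) N =
   - expected_sum sigma' (max_stationary tau)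
       (fun s => - stage_payment s) N [::] (point_mass i0).
  rewrite -sumrN; apply: eq_bigr => w _.
  by rewrite sumrN mulrN opprK.
rewrite -lerN2 opprK; apply: le_trans (bound _ _) _.
- by move=> i; rewrite lerN2 top_ge.
- move=> h [i [a b]].
  rewrite /action_prob mulf_eq0 negb_or => /andP[_ /point_mass_neq0].
  rewrite /stage_payment /stage_trans /stage_min /stage_max /= => ->.
  have := step i a; rewrite /local_value.
  under [X in _ -> _ + X <= _]eq_bigr do rewrite mulrN.
  by rewrite sumrN; lra.
by rewrite le_eqVlt; apply/orP; left; apply/eqP; ring.
Qed.

End LongRunAverage.

(** * One-player operators and gains of pure policies *)

Section Operators.
Context {R : realType} {n : nat} (G : game R n).
Implicit Types (sigma : min_policy G) (tau : max_policy G) (x y : 'cV[R]_n).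

Definition max_operator sigma x : 'cV[R]_n :=
  \col_i fmax predT (fun b => local_value x (sigma i) b).
Definition min_operator tau x : 'cV[R]_n :=
  \col_i fmin predT (fun a => local_value x a (tau i)).

Lemma minact_inhabited i : exists a : minact G i, true.
Proof. by have /card_gt0P[a _] := minact_gt0 G i; exists a. Qed.

Lemma maxact_inhabited i : exists b : maxact G i, true.
Proof. by have /card_gt0P[b _] := maxact_gt0 G i; exists b. Qed.

Lemma local_valueB x y i (a : minact G i) (b : maxact G i) :
  local_value x a b - local_value y a b =
  \sum_j trans G a b j * (x j 0 - y j 0).
Proof.
under eq_bigr do rewrite mulrBr.
by rewrite sumrB /local_value; ring.
Qed.

Lemma max_operator_attained sigma x : exists tau : max_policy G,
  forall i, max_operator sigma x i 0 = local_value x (sigma i) (tau i).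
Proof.
have pick i : exists b, max_operator sigma x i 0 = local_value x (sigma i) b.
  have [b0 _] := maxact_inhabited i; rewrite mxE.
  have [b _ ->] :=
    fmax_attained (fun b => local_value x (sigma i) b) (isT : predT b0).
  by exists b.
by exists (fun i => projT1 (cid (pick i))) => i; exact: projT2 (cid (pick i)).
Qed.

Lemma min_operator_attained tau x : exists sigma : min_policy G,
  forall i, min_operator tau x i 0 = local_value x (sigma i) (tau i).
Proof.
have pick i : exists a, min_operator tau x i 0 = local_value x a (tau i).
  have [a0 _] := minact_inhabited i; rewrite mxE.
  have [a _ ->] :=
    fmin_attained (fun a => local_value x a (tau i)) (isT : predT a0).
  by exists a.
by exists (fun i => projT1 (cid (pick i))) => i; exact: projT2 (cid (pick i)).
Qed.

Lemma max_operator_dominated sigma : dominated G (max_operator sigma).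
Proof.
move=> x y i; have [tau tauE] := max_operator_attained sigma x.
exists (sigma i), (tau i); rewrite -local_valueB tauE lerD2l lerN2 mxE.
exact: (fmax_ge (fun b => local_value y (sigma i) b)).
Qed.

Lemma min_operator_dominated tau : dominated G (min_operator tau).
Proof.
move=> x y i; have [sigma sigmaE] := min_operator_attained tau y.
exists (sigma i), (tau i); rewrite -local_valueB sigmaE lerD2r mxE.
exact: (fmin_le (fun a => local_value x a (tau i))).
Qed.

Lemma shapley_attained x : exists sigma : min_policy G,
  forall i, shapley G x i 0 = max_operator sigma x i 0.
Proof.
have pick i : exists a : minact G i,
    shapley G x i 0 = fmax predT (fun b => local_value x a b).
  have [a0 _] := minact_inhabited i; rewrite mxE.
  have [a _ ->] := fmin_attained (fun a : minact G i =>
    fmax predT (fun b => local_value x a b)) (isT : predT a0).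
  by exists a.
exists (fun i => projT1 (cid (pick i))) => i; rewrite [RHS]mxE.
exact: projT2 (cid (pick i)).
Qed.

Lemma shapley_dominated : dominated G (shapley G).
Proof.
move=> x y i; have [sigma sigmaE] := shapley_attained y.
have [a [b ab]] := max_operator_dominated sigma x y i.
exists a, b; apply: le_trans ab; rewrite sigmaE lerD2r [leLHS]mxE [leRHS]mxE.
exact: (fmin_le (fun a : minact G i =>
  fmax predT (fun b => local_value x a b))).
Qed.

Lemma shapley0_norm i : `|shapley G 0 i 0| <= payment_norm G.
Proof.
have [sigma ->] := shapley_attained 0.
have [tau ->] := max_operator_attained sigma 0.
rewrite /local_value big1 => [|j _]; last by rewrite mxE mulr0.
rewrite addr0.
exact: (@fmax_ge _ _ predT (fun s => `|stage_payment s|)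
  (existT _ i (sigma i, tau i) : stage G)).
Qed.

End Operators.

Section GeometricDecay.
Context {R : realType}.

(** Uses 1 - c <= exp(-c). *)
Lemma geometric_decay (c D e : R) : 0 < c -> c <= 1 -> 0 <= D -> 0 < e ->
  (1 - c) ^+ (Num.truncn (ln (D / e) / c)).+1 * D <= e.
Proof.
move=> c0 c1 D0 e0; have [->|Dn] := eqVneq D 0; first by rewrite mulr0 ltW.
have Dp : 0 < D by rewrite lt_def Dn.
set q := (Num.truncn _).+1.
have qX : ln (D / e) <= c * q%:R.
  by rewrite [leRHS]mulrC -ler_pdivrMr//; exact: ltW (truncnS_gt _).
have : (1 - c) ^+ q <= expR (- (c * q%:R)).
  rewrite -mulNr expRM_natr lerXn2r ?nnegrE ?expR_ge0 ?subr_ge0//.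
  exact: expR_ge1Dx.
have /[swap]/le_trans/[apply] : expR (- (c * q%:R)) <= expR (- ln (D / e)).
  by rewrite ler_expR lerN2.
rewrite expRN lnK ?posrE ?divr_gt0// invf_div => h.
by rewrite -ler_pdivlMr.
Qed.

End GeometricDecay.

Section Gain.
Context {R : realType} {n : nat} (G : game R n) (M : nat).
Hypothesis uni : unichain_game G.
Hypothesis M0 : (0 < M)%N.
Hypothesis rational : forall i (a : minact G i) (b : maxact G i) j,
  exists m : int, trans G a b j = m%:~R / M%:R.
Hypothesis integral : forall i (a : minact G i) (b : maxact G i),
  exists m : int, payment G a b = m%:~R.

(** An average payment under an invariant probability of the pair, known through
    what is needed of it: a bounded denominator, and how it compares with
    potentials. *)
Definition gain (sigma : min_policy G) (tau : max_policy G) (g : R) : Prop :=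
  [/\ exists p d : int,
        [/\ 0 < d, d <= (n * M ^ (n - 1))%:Z & g = p%:~R / d%:~R],
      forall (x : 'cV[R]_n) c,
        (forall i, local_value x (sigma i) (tau i) <= x i 0 + c) -> g <= c &
      forall (x : 'cV[R]_n) c,
        (forall i, x i 0 + c <= local_value x (sigma i) (tau i)) -> c <= g].

Lemma gain_exists sigma tau : exists g, gain sigma tau g.
Proof.
have P0 i j : 0 <= policy_mx sigma tau i j by rewrite mxE trans_ge0.
have P1 i : \sum_j policy_mx sigma tau i j = 1.
  by under eq_bigr do rewrite mxE; rewrite trans_sum1.
have Prat i j : exists m : int, policy_mx sigma tau i j = m%:~R / M%:R.
  by rewrite mxE; exact: rational.
have [w [wb w0 winv]] := integer_invariant_vector P0 P1 (uni sigma tau) M0 Prat.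
pose d := \sum_j w j; pose r i := projT1 (cid (integral (sigma i) (tau i))).
have dR : 0 < d%:~R :> R by rewrite ltr0z.
have rE i : payment G (sigma i) (tau i) = (r i)%:~R.
  exact: projT2 (cid (integral (sigma i) (tau i))).
have wR i : 0 <= (w i)%:~R :> R by rewrite ler0z; case/andP: (wb i).
have total (x : 'cV[R]_n) :
    \sum_i (w i)%:~R * local_value x (sigma i) (tau i) =
    (\sum_i w i * r i)%:~R + \sum_i (w i)%:~R * x i 0.
  under eq_bigr do rewrite mulrDr rE -intrM.
  rewrite big_split/= rmorph_sum/=; congr (_ + _).
  under eq_bigr do rewrite mulr_sumr.
  rewrite exchange_big/=; apply: eq_bigr => j _.
  rewrite -winv mulr_suml; apply: eq_bigr => i _.
  by rewrite [policy_mx _ _ _ _]mxE mulrA.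
have shift (x : 'cV[R]_n) c :
    \sum_i (w i)%:~R * (x i 0 + c) = c * d%:~R + \sum_i (w i)%:~R * x i 0.
  under eq_bigr do rewrite mulrDr.
  by rewrite big_split/= -mulr_suml rmorph_sum/= addrC mulrC.
exists ((\sum_i w i * r i)%:~R / d%:~R); split.
- exists (\sum_i w i * r i), d; split=> //.
  have -> : (n * M ^ (n - 1))%:Z = \sum_(j < n) (M ^ (n - 1))%:Z.
    by rewrite sumr_const card_ord -mulr_natl PoszM natz.
  by apply: ler_sum => j _; case/andP: (wb j).
- move=> x c h; rewrite ler_pdivrMr// -(lerD2r (\sum_i (w i)%:~R * x i 0)).
  by rewrite -total -shift; apply: ler_sum => i _; rewrite ler_wpM2l.
- move=> x c h; rewrite ler_pdivlMr// -(lerD2r (\sum_i (w i)%:~R * x i 0)).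
  by rewrite -total -shift; apply: ler_sum => i _; rewrite ler_wpM2l.
Qed.

(** Distinct fractions p1/d1 and p2/d2 differ by at least 1/(d1 d2). *)
Lemma gain_gap s1 t1 g1 s2 t2 g2 : gain s1 t1 g1 -> gain s2 t2 g2 -> g1 < g2 ->
  (n%:R ^+ 2 * M%:R ^+ (2 * (n - 1)))^-1 <= g2 - g1.
Proof.
move=> [[p1 [d1 [d10 d1B ->]]] _ _] [[p2 [d2 [d20 d2B ->]]] _ _].
have d1R : 0 < d1%:~R :> R by rewrite ltr0z.
have d2R : 0 < d2%:~R :> R by rewrite ltr0z.
rewrite ltr_pdivrMr// mulrAC ltr_pdivlMr// -!intrM ltr_int => lt12.
have -> : p2%:~R / d2%:~R - p1%:~R / d1%:~R =
    (p2 * d1 - p1 * d2)%:~R / (d1 * d2)%:~R :> R.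
  by rewrite !(rmorphB, rmorphM)/=; field; rewrite !gt_eqF.
have num : 1 <= (p2 * d1 - p1 * d2)%:~R :> R by rewrite ler1z; clear -lt12; lia.
have den : (d1 * d2)%:~R <= n%:R ^+ 2 * M%:R ^+ (2 * (n - 1)) :> R.
  have -> : n%:R ^+ 2 * M%:R ^+ (2 * (n - 1)) =
      (n * M ^ (n - 1))%:Z%:~R * (n * M ^ (n - 1))%:Z%:~R :> R.
    by rewrite -!pmulrn natrM natrX mulnC exprM; ring.
  by rewrite intrM ler_pM ?ler_int// ler0z ltW.
have dp : 0 < (d1 * d2)%:~R :> R by rewrite intrM mulr_gt0.
apply: (@le_trans _ _ (d1 * d2)%:~R^-1).
  by rewrite lef_pV2// posrE// (lt_le_trans dp).
by rewrite -[leLHS]mul1r ler_wpM2r// invr_ge0 ltW.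
Qed.

End Gain.

(** * Optimality of greedy policies *)

Section Damping.
Context {R : realType} {n : nat} (G : game R n) (theta : R).
Hypotheses (th0 : 0 < theta) (th1 : theta < 1).
Hypothesis theta_le : forall i (a : minact G i) (b : maxact G i) j,
  i != j -> 0 < trans G a b j -> theta <= (1 - theta) * trans G a b j.

Lemma damp_sub (S : 'cV[R]_n -> 'cV[R]_n) x :
  damp theta S x - x = (1 - theta) *: (S x - x).
Proof. by apply/colP => i; rewrite !mxE; ring. Qed.

(** The exact iterates have increments tending to 0 in Hilbert's seminorm. *)
Lemma approximate_eigenvector (S : 'cV[R]_n -> 'cV[R]_n) k e (i0 : 'I_n) :
  dominated G S -> scrambling G theta k -> 0 < e ->
  exists x, hilbert_seminorm (S x - x) <= e.
Proof.
move=> domS sc e0; pose X m := iter m (damp theta S) 0.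
have noise m : hilbert_seminorm (X m.+1 - damp theta S (X m)) <= 0.
  by apply: (hilbert_le i0) => i j; rewrite subrr !mxE subrr.
have t0 : 0 < 1 - theta by rewrite subr_gt0.
have c0 : 0 < theta ^+ k by rewrite exprn_gt0.
have c1 : theta ^+ k <= 1 by rewrite exprn_ile1 ?ltW.
have D0 := hilbert_ge0 (X 1 - X 0) i0.
have := geometric_decay c0 c1 D0 (mulr_gt0 t0 e0).
set q := (Num.truncn _).+1 => small; exists (X (q * k)%N).
have -> : S (X (q * k)%N) - X (q * k)%N =
    (1 - theta)^-1 *: (X (q * k).+1 - X (q * k)%N).
  rewrite [X _.+1]/= -/(damp theta S (X (q * k))) damp_sub scalerA.
  rewrite mulVf ?scale1r//.
  by rewrite gt_eqF.
apply: le_trans (hilbertZ _ i0 _) _; first by rewrite invr_ge0 ltW.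
rewrite mulrC ler_pdivrMr// [leRHS]mulrC.
apply: le_trans
  (noisy_increments th0 th1 theta_le domS i0 noise q sc (lexx 0)) _.
by rewrite mulr0 mul0r addr0.
Qed.

End Damping.

Section Optimality.
Context {R : realType} {n : nat} (G : game R n) (M : nat) (theta : R) (k : nat).
Hypotheses (th0 : 0 < theta) (th1 : theta < 1).
Hypothesis theta_le : forall i (a : minact G i) (b : maxact G i) j,
  i != j -> 0 < trans G a b j -> theta <= (1 - theta) * trans G a b j.
Hypothesis sc : scrambling G theta k.
Hypothesis uni : unichain_game G.
Hypothesis M0 : (0 < M)%N.
Hypothesis rational : forall i (a : minact G i) (b : maxact G i) j,
  exists m : int, trans G a b j = m%:~R / M%:R.
Hypothesis integral : forall i (a : minact G i) (b : maxact G i),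
  exists m : int, payment G a b = m%:~R.

Let gainP := gain_exists uni M0 rational integral.

Lemma increment_bounds (S : 'cV[R]_n -> 'cV[R]_n) (x : 'cV[R]_n) i :
  x i 0 + bot (S x - x) <= S x i 0 <= x i 0 + top (S x - x).
Proof.
have := top_ge (S x - x) i; have := bot_le (S x - x) i.
by rewrite !mxE => ? ?; apply/andP; split; lra.
Qed.

(** An approximate eigenvector of the operator of Max against sigma bounds every
    reply from above by the top of its increment; a pure policy attaining the
    maxima gains at least the bottom, which is nearly the same number. *)
Lemma chi_sup_le_gain sigma chi i (tau' : max_strategy G) :
  (forall tau g, gain M sigma tau g -> g <= chi) ->
  (chi_sup i (min_stationary sigma) tau' <= chi%:E)%E.
Proof.
move=> best; apply/lee_addgt0Pr => e e0; rewrite -EFinD.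
have [x xe] := approximate_eigenvector th0 th1 theta_le i
  (max_operator_dominated sigma) sc e0.
have [tau tauE] := max_operator_attained sigma x.
have [g gP] := gainP sigma tau.
have inc j := increment_bounds (max_operator sigma) x j.
apply: (@le_trans _ _ (top (max_operator sigma x - x))%:E).
  apply: chi_sup_le => j b; have /andP[_] := inc j; apply: le_trans.
  by rewrite mxE; exact: (fmax_ge (fun b => local_value x (sigma j) b)).
have lower : bot (max_operator sigma x - x) <= g.
  by case: gP => _ _ /(_ x); apply=> j; rewrite -tauE; have /andP[] := inc j.
have := best _ _ gP; rewrite lee_fin.
by move: xe lower; rewrite /hilbert_seminorm; lra.
Qed.

Lemma chi_inf_ge_gain tau chi i (sigma' : min_strategy G) :
  (forall sigma g, gain M sigma tau g -> chi <= g) ->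
  (chi%:E <= chi_inf i sigma' (max_stationary tau))%E.
Proof.
move=> best; apply/lee_addgt0Pr => e e0; rewrite -leeBlDr// -EFinB.
have [x xe] := approximate_eigenvector th0 th1 theta_le i
  (min_operator_dominated tau) sc e0.
have [sigma sigmaE] := min_operator_attained tau x.
have [g gP] := gainP sigma tau.
have inc j := increment_bounds (min_operator tau) x j.
apply: (@le_trans _ _ (bot (min_operator tau x - x))%:E); last first.
  apply: chi_inf_ge => j a; have /andP[+ _] := inc j; move=> /le_trans; apply.
  by rewrite mxE; exact: (fmin_le (fun a => local_value x a (tau j))).
have upper : g <= top (min_operator tau x - x).
  case: gP => _ /(_ x) + _; apply=> j.
  by rewrite -sigmaE; have /andP[] := inc j.
have := best _ _ gP; rewrite lee_fin.
by move: xe upper; rewrite /hilbert_seminorm; lra.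
Qed.

Lemma saddle_optimal (sigma : min_policy G) (tau : max_policy G) chi :
  (forall i tau', (chi_sup i (min_stationary sigma) tau' <= chi%:E)%E) ->
  (forall i sigma', (chi%:E <= chi_inf i sigma' (max_stationary tau))%E) ->
  optimal_policies sigma tau.
Proof.
move=> up lo; exists (const_mx chi); last by move=> i s t; rewrite mxE; split.
move=> i; rewrite mxE; split; apply/eqP; rewrite eq_le; apply/andP; split.
- apply: ge_ereal_inf; eexists; first by exists (min_stationary sigma).
  by apply: ub_ereal_sup => _ [t _ <-].
- apply/ereal_infP => _ [s _ <-]; apply: le_ereal_sup_tmp.
  eexists; first by exists (max_stationary tau).
  exact: le_trans (lo i s) (limn_einf_sup _).
- apply: ub_ereal_sup => _ [t _ <-]; apply: ge_ereal_inf.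
  eexists; first by exists (min_stationary sigma).
  exact: le_trans (limn_einf_sup _) (up i t).
- apply: le_ereal_sup_tmp; eexists; first by exists (max_stationary tau).
  by apply/ereal_infP => _ [s _ <-].
Qed.

(** The increment of T at x brackets the gains of all pure replies to sigma and
    to tau, within less than the gap between two gains. *)
Lemma greedy_optimal x (sigma : min_policy G) (tau : max_policy G) :
  hilbert_seminorm (shapley G x - x) < (n%:R ^+ 2 * M%:R ^+ (2 * (n - 1)))^-1 ->
  greedy x sigma tau -> optimal_policies sigma tau.
Proof.
move=> small gr.
have [chi chiP] := gainP sigma tau.
pose a := bot (shapley G x - x); pose b := top (shapley G x - x).
have up i b' : local_value x (sigma i) b' <= x i 0 + b.
  have /andP[_] := increment_bounds (shapley G) x i; apply: le_trans.
  by rewrite (gr i).1; exact: (fmax_ge (fun b => local_value x (sigma i) b)).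
have lo i a' : x i 0 + a <= local_value x a' (tau i).
  have /andP[+ _] := increment_bounds (shapley G) x i; move=> /le_trans; apply.
  by rewrite (gr i).2; exact: (fmin_le (fun a => local_value x a (tau i))).
have [chib chia] : chi <= b /\ a <= chi.
  by case: chiP => _ u l; split; [exact: u|exact: l].
apply: (@saddle_optimal _ _ chi) => i.
  move=> tau'; apply: chi_sup_le_gain => t g gP.
  rewrite leNgt; apply/negP => lt; have := gain_gap chiP gP lt.
  case: gP => _ /(_ x b)/(_ (fun j => up j _)) gb _.
  by move: small; rewrite /hilbert_seminorm -/a -/b; lra.
move=> sigma'; apply: chi_inf_ge_gain => s g gP.
rewrite leNgt; apply/negP => lt.
have := gain_gap gP chiP lt; case: gP => _ _ /(_ x a)/(_ (fun j => lo j _)) ga.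
by move: small; rewrite /hilbert_seminorm -/a -/b; lra.
Qed.

End Optimality.

(** * Complexity of relative value iteration *)

Section DampingParameter.
Context {R : realType} {n : nat} (G : game R n).
Hypothesis nontrivial : exists u, positive_offdiag (G := G) u.

Lemma p_min_gt0 : 0 < p_min G.
Proof.
have [u pu] := nontrivial.
rewrite /p_min; have [v /andP[_ pv] ->] :=
  fmin_attained (fun u => stage_trans u.1 u.2) pu.
exact: pv.
Qed.

Lemma p_min_le i (a : minact G i) (b : maxact G i) j :
  i != j -> 0 < trans G a b j -> p_min G <= trans G a b j.
Proof.
move=> ij ab.
apply: (@fmin_le _ _ (positive_offdiag (G := G)) (fun u => stage_trans u.1 u.2)
  (existT _ i (a, b) : stage G, j)).
by rewrite /positive_offdiag ij.
Qed.

Let theta := p_min G / (1 + p_min G).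

Lemma theta_gt0 : 0 < theta.
Proof. by have p0 := p_min_gt0; rewrite divr_gt0// addr_gt0. Qed.

Lemma theta_lt1 : theta < 1.
Proof.
have p0 := p_min_gt0; rewrite ltr_pdivrMr ?addr_gt0// mul1r.
by rewrite ltrDr.
Qed.

Lemma theta_le_damped i (a : minact G i) (b : maxact G i) j :
  i != j -> 0 < trans G a b j -> theta <= (1 - theta) * trans G a b j.
Proof.
move=> ij ab; have p0 := p_min_gt0.
have p1 : 1 + p_min G != 0 by rewrite gt_eqF// addr_gt0.
have -> : 1 - theta = (1 + p_min G)^-1 by rewrite /theta; field.
by rewrite mulrC ler_wpM2r ?p_min_le// invr_ge0 ltW// addr_gt0.
Qed.

End DampingParameter.

Section Complexity.
Context {R : realType} {n : nat} (G : game R n) (theta : R) (k : nat).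
Context (eta eps : R) (oracle : 'cV[R]_n -> 'cV[R]_n) (i0 : 'I_n).
Hypotheses (th0 : 0 < theta) (th1 : theta < 1) (k0 : (0 < k)%N).
Hypothesis theta_le : forall i (a : minact G i) (b : maxact G i) j,
  i != j -> 0 < trans G a b j -> theta <= (1 - theta) * trans G a b j.
Hypothesis sc : scrambling G theta k.
Hypotheses (eta0 : 0 < eta) (eps0 : 0 < eps).
Hypothesis eta_small : eta * (12 + 24 * k%:R * theta ^- k) <= eps.
Hypothesis oracleP : forall x, `|oracle x - damped_shapley G theta x| <= eta.

Let X := rvi_iter oracle.

(** The normalization subtracts a constant vector, invisible to the seminorm. *)
Lemma rvi_increment m :
  hilbert_seminorm (X m - oracle (X m)) = hilbert_seminorm (X m.+1 - X m).
Proof.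
rewrite -(hilbertN _ i0) opprB -(hilbert_const _ i0 (- top (oracle (X m)))).
by congr hilbert_seminorm; apply/colP => i; rewrite /= !mxE; ring.
Qed.

Lemma rvi_noise m :
  hilbert_seminorm (X m.+1 - damped_shapley G theta (X m)) <= 2 * eta.
Proof.
apply: le_trans (hilbert_norm i0 (oracleP (X m))).
rewrite -[leRHS](hilbert_const _ i0 (- top (oracle (X m)))).
rewrite le_eqVlt; apply/orP; left; apply/eqP.
by congr hilbert_seminorm; apply/colP => i; rewrite /= !mxE; ring.
Qed.

Lemma rvi_first_increment :
  hilbert_seminorm (X 1%N - X 0%N) <=
  2 * (1 - theta) * payment_norm G + 2 * eta.
Proof.
have -> : X 1%N - X 0%N =
    (X 1%N - damped_shapley G theta (X 0%N)) + (1 - theta) *: shapley G 0.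
  by apply/colP => i; rewrite /= !mxE; ring.
apply: le_trans (hilbertD _ _ i0) _; rewrite addrC lerD ?rvi_noise//.
apply: le_trans (hilbertZ _ i0 _) _; first by rewrite subr_ge0 ltW.
rewrite -mulrA mulrCA ler_wpM2l ?subr_ge0 ?(ltW th1)//.
apply: (hilbert_le i0) => i j.
have := @shapley0_norm _ _ G i; have := @shapley0_norm _ _ G j.
rewrite !ler_norml => /andP[? ?] /andP[? ?]; lra.
Qed.

(** A phase consists of k iterations. The logarithm compares the first increment
    2 (1 - theta) |r| with eps / 6, the part of the threshold eps / 3 left once
    the errors of the oracle are deducted. *)
Definition phase_count : nat :=
  (Num.truncn
    (ln (12 * (payment_norm G * ((1 - theta) / eps))) / theta ^+ k)).+1.

Lemma payment_norm_ge0 : 0 <= payment_norm G.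
Proof. exact: le_trans (normr_ge0 _) (@shapley0_norm _ _ G i0). Qed.

Lemma rvi_test_phase : rvi_test oracle eps (X (phase_count * k)).
Proof.
rewrite /rvi_test rvi_increment.
have c0 : 0 < theta ^+ k by rewrite exprn_gt0.
have c1 : theta ^+ k <= 1 by rewrite exprn_ile1 ?ltW.
have e2 : 0 <= 2 * eta by rewrite mulr_ge0// ltW.
have t0 : 0 < 1 - theta by rewrite subr_gt0.
apply: le_trans (noisy_increments th0 th1 theta_le (@shapley_dominated _ _ G) i0
  rvi_noise phase_count sc e2) _.
have D0 : 0 <= 2 * (1 - theta) * payment_norm G.
  by rewrite !mulr_ge0 ?payment_norm_ge0// ltW.
have := geometric_decay c0 c1 D0 (divr_gt0 eps0 (ltr0n R 6)).
(* The logarithm in [phase_count] is that of first increment over target. *)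
have -> : 2 * (1 - theta) * payment_norm G / (eps / 6) =
    12 * (payment_norm G * ((1 - theta) / eps)).
  by field; rewrite gt_eqF.
rewrite -/phase_count => decay.
have cq : (1 - theta ^+ k) ^+ phase_count <= 1.
  by rewrite exprn_ile1 ?subr_ge0// gerBl ltW.
have cq0 : 0 <= (1 - theta ^+ k) ^+ phase_count by rewrite exprn_ge0// subr_ge0.
have := ler_wpM2l cq0 rvi_first_increment; rewrite mulrDr.
have := ler_wpM2r e2 cq.
move: eta_small decay; rewrite mul1r mulrDr.
have -> : eta * (24 * k%:R * theta ^- k) =
    6 * (2 * k%:R * (2 * eta) / theta ^+ k).
  by ring.
move: cq cq0; move: (_ ^+ phase_count) (_ / theta ^+ k) => v u.
lra.
Qed.

Lemma rvi_stops : exists N x alpha beta,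
  [/\ rvi_returns oracle eps N x alpha beta, (N <= phase_count * k)%N &
      hilbert_seminorm (shapley G x - x) < eps / (1 - theta)].
Proof.
have ex : exists N, (0 < N)%N && rvi_test oracle eps (X N).
  by exists (phase_count * k)%N; rewrite rvi_test_phase muln_gt0 k0.
case: (ex_minnP ex) => N /andP[N0 test] minN.
exists N, (X N), (bot (oracle (X N) - X N)), (top (oracle (X N) - X N)).
have t0 : 0 < 1 - theta by rewrite subr_gt0.
split.
- split=> // m /andP[m0 mN]; apply/negP => mt.
  by have := minN m; rewrite m0 mt => /(_ isT); rewrite leqNgt mN.
- by apply: minN; rewrite rvi_test_phase muln_gt0 k0.
have -> : shapley G (X N) - X N =
    (1 - theta)^-1 *: (damped_shapley G theta (X N) - X N).
  rewrite (_ : damped_shapley G theta (X N) = damp theta (shapley G) (X N))//.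
  by rewrite damp_sub scalerA mulVf ?scale1r// gt_eqF.
apply: le_lt_trans (hilbertZ _ i0 _) _; first by rewrite invr_ge0 ltW.
rewrite mulrC ltr_pM2r ?invr_gt0//.
have -> : damped_shapley G theta (X N) - X N =
    - ((X N - oracle (X N)) + (oracle (X N) - damped_shapley G theta (X N))).
  by apply/colP => i; rewrite !mxE; ring.
rewrite (hilbertN _ i0); apply: le_lt_trans (hilbertD _ _ i0) _.
have := hilbert_norm i0 (oracleP (X N)); move: test; rewrite /rvi_test.
have : 0 <= eta * (24 * k%:R * theta ^- k).
  by rewrite !mulr_ge0 ?invr_ge0 ?exprn_ge0 ?(ltW eta0) ?(ltW th0).
move: eps0 eta_small; rewrite mulrDr; move: (eta * (24 * _ * _)) => u; lra.
Qed.

End Complexity.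

Lemma payment_norm_ge1 (R : realType) (n : nat) (G : game R n) :
  (forall i (a : minact G i) (b : maxact G i),
     exists m : int, payment G a b = m%:~R) ->
  0 < payment_norm G -> 1 <= payment_norm G.
Proof.
move=> integral; rewrite /payment_norm.
case: (pickP (predT : pred (stage G))) => [s0 _|none]; last first.
  by rewrite /fmax; case: pickP => [s|_]; [rewrite none|rewrite ltxx].
have [[i [a b]] _ ->] :=
  fmax_attained (fun s : stage G => `|stage_payment s|) (isT : predT s0).
rewrite /stage_payment /stage_min /stage_max /=.
have [m ->] := integral i a b; rewrite -intr_norm ltr0z ler1z; lia.
Qed.

(** The term |ln (1 - theta)| of the bound pays for rounding the number of
    phases up: it is at least theta, hence at least theta^k. *)
Lemma phase_bound (R : realType) (n : nat) (G : game R n) (M : nat)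
    (theta : R) k :
  0 < theta -> theta < 1 -> (0 < k)%N -> (0 < n)%N -> (0 < M)%N ->
  0 <= payment_norm G -> (0 < payment_norm G -> 1 <= payment_norm G) ->
  (phase_count G theta k
    ((1 - theta) * (n%:R ^+ 2 * M%:R ^+ (2 * (n - 1)))^-1) * k)%:R <=
  (`|ln (1 - theta)| + 2 * ln n%:R + 2 * (n%:R - 1) * ln M%:R
    + ln 12 + ln (payment_norm G)) * theta ^- k * k%:R.
Proof.
move=> th0 th1 k0 n0 M0 r0 r1.
have c0 : 0 < theta ^+ k by rewrite exprn_gt0.
have t0 : 0 < 1 - theta by rewrite subr_gt0.
rewrite natrM ler_wpM2r// /phase_count -natr1.
set L := 12 * _.
have nR : 1 <= n%:R :> R by rewrite ler1n.
have MR : 1 <= M%:R :> R by rewrite ler1n.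
have lnn_ge0 : 0 <= ln n%:R :> R by rewrite ln_ge0.
have lnM_ge0 : 0 <= ln M%:R :> R by rewrite ln_ge0.
have ln12_ge0 : 0 <= ln 12 :> R by rewrite ln_ge0// ler1n.
have nM1 : 0 <= (n%:R - 1) * ln M%:R :> R by rewrite mulr_ge0// subr_ge0.
have LE : L = 12 * (payment_norm G * (n%:R ^+ 2 * M%:R ^+ (2 * (n - 1)))).
  rewrite /L; congr (_ * (_ * _)); rewrite invfM invrK mulrA mulfV ?mul1r//.
  by rewrite gt_eqF.
have lnL : 0 <= ln L <= 2 * ln n%:R + 2 * (n%:R - 1) * ln M%:R
    + ln 12 + ln (payment_norm G).
  have [e|ne] := eqVneq (payment_norm G) 0.
    by rewrite LE e mul0r mulr0 ln0 ?lexx//=; lra.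
  have rp : 0 < payment_norm G by rewrite lt_def ne.
  have np : 0 < n%:R :> R by exact: lt_le_trans nR.
  have Mp : 0 < M%:R :> R by exact: lt_le_trans MR.
  apply/andP; split.
    rewrite ln_ge0// LE !mulr_ege1 ?r1 ?exprn_ege1// ?ler1n//.
  rewrite LE !lnM ?posrE ?mulr_gt0 ?exprn_gt0 ?ltr0n// !lnXn//.
  rewrite -[ln M%:R *+ _]mulr_natr natrM natrB//.
  lra.
have /andP[L0 L1] := lnL.
have trunc : (Num.truncn (ln L / theta ^+ k))%:R <= ln L / theta ^+ k.
  by rewrite truncn_le divr_ge0// ltW.
have one : 1 <= `|ln (1 - theta)| * theta ^- k.
  rewrite ler_pdivlMr// mul1r.
  apply: (@le_trans _ _ theta).
    by rewrite -(prednK k0) exprS ger_pMr// exprn_ile1 ?ltW.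
  rewrite -normrN; apply: le_trans (ler_norm _).
  by rewrite lerNr le_ln1Dx// ltrN2.
apply: le_trans (lerD trunc one) _.
by rewrite -mulrDl ler_wpM2r ?invr_ge0 ?(ltW c0)//; lra.
Qed.

Theorem theorem23 (R : realType) (n : nat) (G : game R n) (M : nat) (eta : R)
    (oracle : 'cV[R]_n -> 'cV[R]_n) :
  let theta := p_min G / (1 + p_min G) in
  let k := unichain_index G theta in
  let eps := (1 - theta) * (n%:R ^+ 2 * M%:R ^+ (2 * (n - 1)))^-1 in
  unichain_game G ->
  (exists u, positive_offdiag (G := G) u) ->
  (0 < M)%N ->
  (forall i (a : minact G i) (b : maxact G i) j,
     exists m : int, trans G a b j = m%:~R / M%:R) ->
  (forall i (a : minact G i) (b : maxact G i),
     exists m : int, payment G a b = m%:~R) ->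
  0 < eta ->
  eta * (12 + 24 * k%:R * theta ^- k) <= eps ->
  (forall x, `|oracle x - damped_shapley G theta x| <= eta) ->
  exists (N : nat) (x : 'cV[R]_n) (alpha beta : R),
    [/\ rvi_returns oracle eps N x alpha beta,
        N%:R <= (`|ln (1 - theta)| + 2 * ln n%:R + 2 * (n%:R - 1) * ln M%:R
                 + ln 12 + ln (payment_norm G)) * theta ^- k * k%:R &
        forall (sigma : min_policy G) (tau : max_policy G),
          greedy x sigma tau -> optimal_policies sigma tau].
Proof.
move=> theta k eps uni nontrivial M0 rational integral eta0 eta_small oracleP.
have [[[i1 ab] i2] /andP[/= ne _]] := nontrivial.
have th0 : 0 < theta := theta_gt0 nontrivial.
have th1 : theta < 1 := theta_lt1 nontrivial.
have theta_le := theta_le_damped nontrivial.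
have sc : scrambling G theta k := unichain_indexP th0 th1 uni.
have k0 : (0 < k)%N := scrambling_gt0 ne sc.
have n0 : (0 < n)%N by case: (n) i1 {ab ne} => [[]|].
have eps0 : 0 < eps.
  by rewrite mulr_gt0 ?subr_gt0// invr_gt0 mulr_gt0// exprn_gt0// ltr0n.
have [N [x [alpha [beta [ret NB small]]]]] :=
  rvi_stops i1 th0 th1 k0 theta_le sc eta0 eps0 eta_small oracleP.
exists N, x, alpha, beta; split=> //.
  apply: le_trans (phase_bound th0 th1 k0 n0 M0 (payment_norm_ge0 G i1)
    (payment_norm_ge1 integral)).
  by rewrite ler_nat.
move=> sigma tau.
apply: (greedy_optimal th0 th1 theta_le sc uni M0 rational integral).
by move: small; rewrite /eps mulrAC mulfV ?mul1r// gt_eqF// subr_gt0.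
Qed.
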